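(* For any given thresholds $\Theta_E,\Theta_F\ge 1$, the condition number $\kappa(\hat G)=\lambda_{\max}(\hat G)/\lambda_{\min}(\hat G)$ of the adaptive BDDC preconditioned operator $\hat G=M_{BDDC}^{-1}\hat S:\hat W\to\hat W$ (constructed with these thresholds) satisfies $$\kappa(\hat G)\le C\,\Theta,\qquad \Theta=\max\{\Theta_E,\Theta_F\},$$ where $C$ is a constant depending only on the number of common faces and common edges per subdomain and the number of subdomains sharing a common edge.
   Context: **Discretization.** $\Omega\subset\mathbb R^3$ is a bounded connected Lipschitz domain, $\partial\Omega=\overline{\Gamma_d\cup\Gamma_n\cup\Gamma_r}$ with $\Gamma_d,\Gamma_n,\Gamma_r$ disjoint. $\mathcal T_h=\{\Omega_k\}_{k=1}^{N_h}$ is a partition of $\Omega$ into non-overlapping hexahedra, $h$ the maximal element size. The wave number $\kappa>0$ equals a constant $\kappa_k$ on each $\Omega_k$. Put $\gamma_{kj}=\partial\Omega_k\cap\partial\Omega_j$ ($k\ne j$), $\gamma_k=\partial\Omega_k\cap\partial\Omega$; $\mathbf n_k$ is the outward normal of $\Omega_k$. Let $p\ge1$ and let $\alpha_1,\dots,\alpha_p\in\mathbb R^3$ be distinct unit vectors. $V_p(\mathcal T_h)$ is the complex span of the basis functions $\varphi_{m,l}$ ($1\le m\le N_h$, $1\le l\le p$) equal to $e^{i\kappa_m x\cdot\alpha_l}$ on $\bar\Omega_m$ and $0$ elsewhere; they are renumbered $\varphi_s$, $s=(m-1)p+l$. With $\kappa_{kj}=(\kappa_k+\kappa_j)/2$,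 $\alpha_{kj}=h^{-1}+|\kappa_{kj}|$, $\beta_{kj}=h^{-1}|\kappa_{kj}|^{-2}+|\kappa_{kj}|^{-1}$, $\theta_{k1}=h^{-1}+|\kappa_k|$, $\theta_{k2}=\theta_{k3}=h^{-1}|\kappa_k|^{-2}+|\kappa_k|^{-1}$, and $u_k=u|_{\Omega_k}$, define $$a(u,v)=\sum_{k}\Big(\theta_{k1}\int_{\gamma_k\cap\Gamma_d}u_k\overline{v_k}+\theta_{k2}\int_{\gamma_k\cap\Gamma_n}\partial_{\mathbf n_k}u_k\overline{\partial_{\mathbf n_k}v_k}+\theta_{k3}\int_{\gamma_k\cap\Gamma_r}(\partial_{\mathbf n_k}+i\kappa_k)u_k\overline{(\partial_{\mathbf n_k}+i\kappa_k)v_k}\Big)$$ $$+\sum_{j\ne k}\Big(\alpha_{kj}\int_{\gamma_{kj}}(u_k-u_j)\overline{(v_k-v_j)}+\beta_{kj}\int_{\gamma_{kj}}(\partial_{\mathbf n_k}u_k+\partial_{\mathbf n_j}u_j)\overline{(\partial_{\mathbf n_k}v_k+\partial_{\mathbf n_j}v_j)}\Big).$$ This form is Hermitian positive definite on $V_p(\mathcal T_h)$. **Subdomains and globs.** $\{D_r\}_{r=1}^{N_d}$ is a non-overlapping subdomain partition of $\Omega$; each $D_r$ consists of several complete elements and parts of elements (subdomain boundaries cut through elements). For a function $\zeta$, its truncation $\zeta^{(r)}$ equals $\zeta$ on $\bar D_r$ and $0$ elsewhere. For a degree of freedom (dof) $k$ let $\mathcal N_k=\{r:\operatorname{supp}\varphi_k\cap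 D_r\ne\emptyset\}$. Dofs with the same $\mathcal N_k$ form a glob $G$, with $\mathcal N_G$ the common set. Globs with $|\mathcal N_G|=1$, $\mathcal N_G=\{r\}$, are the interior dof sets $\mathcal I_r$; globs with $|\mathcal N_G|=2$ are the common faces $\mathcal F_k$ ($1\le k\le N_F$); with $|\mathcal N_G|=4$ the common edges $\mathcal E_k$ ($1\le k\le N_E$); with $|\mathcal N_G|>4$ the common vertices $\mathcal V_k$ ($1\le k\le N_V$); all globs are of one of these kinds. For $X=F,E,V$, write $\mathcal X_k$ for the corresponding glob ($\mathcal F_k,\mathcal E_k,\mathcal V_k$), $n_{X_k}=|\mathcal X_k|$, and $\mathcal M_X^{(r)}=\{k: r\in\mathcal N_{\mathcal X_k}\}$. Let $V_I^{(r)}=\operatorname{span}\{\varphi_l:l\in\mathcal I_r\}$, and let $V^{(r)}$ be the span of $V_I^{(r)}$ and all truncations $\varphi_l^{(r)}$, $l\in\mathcal X_k$, $k\in\mathcal M_X^{(r)}$, $X=F,E,V$. The form $a_r(\cdot,\cdot)$ on $V^{(r)}$ is defined by the same formula as $a$ with $\gamma_k,\gamma_{kj}$ replaced by their parts in $\bar D_r$; thus $a(u,v)=\sum_r a_r(u^{(r)},v^{(r)})$. It is Hermitian positive semidefinite on $V^{(r)}$ and positive definite on $V_I^{(r)}$. **Discrete harmonic spaces.** Let $k_l$ be the global number of the $l$-th dof of $\mathcal X_k$. For $\nu\in\mathcal N_{\mathcal X_k}$ let $\check\phi_l^{X_k,\nu}\in V_I^{(\nu)}$ satisfy $a_\nu(\check\phi_l^{X_k,\nu},v)=-a_\nu(\varphi_{k_l}^{(\nu)},v)$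 for all $v\in V_I^{(\nu)}$. Set $\phi_l^{X_k,\nu}=\varphi_{k_l}^{(\nu)}+\check\phi_l^{X_k,\nu}$ and $\phi_l^{X_k}=\varphi_{k_l}+\sum_{\nu\in\mathcal N_{\mathcal X_k}}\check\phi_l^{X_k,\nu}$, so $\phi_l^{X_k}|_{\bar D_\nu}=\phi_l^{X_k,\nu}|_{\bar D_\nu}$. Let $\Phi_{X_k}=(\phi_1^{X_k},\dots,\phi_{n_{X_k}}^{X_k})^T$, $\Phi_{X_k}^{(\nu)}=(\phi_1^{X_k,\nu},\dots,\phi_{n_{X_k}}^{X_k,\nu})^T$, with spans $W_{X_k}$ and $W_{X_k}^{(\nu)}$; $\hat W=\bigoplus_{X=F,E,V}\bigoplus_k W_{X_k}$ and $W^{(r)}=\bigoplus_{X=F,E,V}\bigoplus_{k\in\mathcal M_X^{(r)}}W_{X_k}^{(r)}$. Let $T_r:W^{(r)}\to\hat W$ be the linear map with $T_r\phi_l^{X_k,r}=\phi_l^{X_k}$, and $T^r:\hat W\to W^{(r)}$ the linear map sending each basis function to its truncation in $D_r$ ($\phi_l^{X_k}\mapsto\phi_l^{X_k,r}$ if $r\in\mathcal N_{\mathcal X_k}$). For $X=F,E$ let $W^{(\nu)}\backslash W_{X_k}^{(\nu)}$ denote the direct sum of the summands of $W^{(\nu)}$ other than $W_{X_k}^{(\nu)}$; $a_\nu$ is positive definite on it. Define $\bar\phi_l^{X_k,\nu}=\phi_l^{X_k,\nu}+\check{\bar\phi}_l^{X_k,\nu}$, where $\check{\bar\phi}_l^{X_k,\nu}\in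 W^{(\nu)}\backslash W_{X_k}^{(\nu)}$ and $a_\nu(\bar\phi_l^{X_k,\nu},v)=0$ for all $v\in W^{(\nu)}\backslash W_{X_k}^{(\nu)}$. **Scaling.** For $X=F,E$ and each $\mathcal X_k$ there are given nonsingular scaling matrices $\vec D_{X_k}^{(\nu)}\in\mathbb C^{n_{X_k}\times n_{X_k}}$, $\nu\in\mathcal N_{\mathcal X_k}$, with $\sum_{\nu\in\mathcal N_{\mathcal X_k}}\vec D_{X_k}^{(\nu)}=I$. The operator $D_{X_k}^{(\nu)}$ acts on $W_{X_k}$ and on every $W_{X_k}^{(\mu)}$ by multiplying coefficient vectors (with respect to $\Phi_{X_k}$, $\Phi_{X_k}^{(\mu)}$) by $\vec D_{X_k}^{(\nu)}$. **Adaptive primal/dual splitting.** For $X=F,E$ let $\vec S_{X_k}^{(\nu)}=(a_\nu(\phi_m^{X_k,\nu},\phi_l^{X_k,\nu}))_{l,m}$, $\vec{\bar S}_{X_k}^{(\nu)}=(a_\nu(\bar\phi_m^{X_k,\nu},\bar\phi_l^{X_k,\nu}))_{l,m}$, $$\vec A_{X_k}^D=\sum_{\nu\in\mathcal N_{\mathcal X_k}}\sum_{\mu\in\mathcal N_{\mathcal X_k}\setminus\{\nu\}}(\vec D_{X_k}^{(\mu)})^H\vec S_{X_k}^{(\nu)}\vec D_{X_k}^{(\mu)},$$ and let $\vec B_{X_k}$ be the parallel sum of the Hermitian positive semidefinite matrices $\vec{\bar S}_{X_k}^{(\nu)}$, $\nu\in\mathcal N_{\mathcal X_k}$ (the parallel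 sum of two such matrices is $A(A+B)^{\dagger}B$, extended associatively; it is Hermitian positive semidefinite and $\le$ each summand in the Loewner order). Consider $\vec A_{X_k}^D\vec v=\lambda\vec B_{X_k}\vec v$. It is assumed that there is a basis $\vec v_1,\dots,\vec v_{n_{X_k}}$ of $\mathbb C^{n_{X_k}}$ of eigenvectors with eigenvalues $\lambda_l\in\mathbb C$ such that $\vec v_l^H\vec A_{X_k}^D\vec v_m=\vec v_l^H\vec B_{X_k}\vec v_m=0$ for $l\ne m$ and, for the threshold $\Theta_X\ge1$ and an integer $n_\Delta^{X_k}\ge0$, $|\lambda_1|\le\dots\le|\lambda_{n_\Delta^{X_k}}|\le\Theta_X\le|\lambda_{n_\Delta^{X_k}+1}|\le\dots\le|\lambda_{n_{X_k}}|$. Put $\vec T_\Delta^{X_k}=(\vec v_1,\dots,\vec v_{n_\Delta^{X_k}})$, $\vec T_\Pi^{X_k}=(\vec v_{n_\Delta^{X_k}+1},\dots,\vec v_{n_{X_k}})$. For $\zeta=\Delta,\Pi$ let $\Phi_\zeta^{X_k}=(\vec T_\zeta^{X_k})^T\Phi_{X_k}$, $\Phi_\zeta^{X_k,\nu}=(\vec T_\zeta^{X_k})^T\Phi_{X_k}^{(\nu)}$, and let $W_{X_k,\zeta}$, $W_{X_k,\zeta}^{(\nu)}$ be their spans. **Partially coupled space and preconditioner.** $W_\Delta^{(r)}=\bigoplus_{X=F,E}\bigoplus_{k\in\mathcal M_X^{(r)}}W_{X_k,\Delta}^{(r)}$, $\;W_\Pi=\bigoplus_{X=F,E}\bigoplus_kW_{X_k,\Pi}\oplus\bigoplus_kW_{V_k}$,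 $\;\tilde W=\big(\bigoplus_{r=1}^{N_d}W_\Delta^{(r)}\big)\oplus W_\Pi$. Every $\tilde w\in\tilde W$ is uniquely $\tilde w=\sum_r\sum_{X=F,E}\sum_{k\in\mathcal M_X^{(r)}}w_{X_k,\Delta}^{(r)}+w_\Pi$ with $w_{X_k,\Delta}^{(r)}\in W_{X_k,\Delta}^{(r)}$, $w_\Pi\in W_\Pi$. Its local part is $\tilde w^{(r)}=\sum_{X=F,E}\sum_{k\in\mathcal M_X^{(r)}}w_{X_k,\Delta}^{(r)}+T^rw_\Pi\in W^{(r)}$. Put $\tilde a(\tilde u,\tilde v)=\sum_ra_r(\tilde u^{(r)},\tilde v^{(r)})$, which is Hermitian positive definite on $\tilde W$. Fix inner products $(\cdot,\cdot)$ on $\hat W$ and $\tilde W$; $^H$ denotes adjoints. Define $\hat S:\hat W\to\hat W$ by $(\hat S\hat u,\hat v)=a(\hat u,\hat v)$ and $\tilde S:\tilde W\to\tilde W$ by $(\tilde S\tilde u,\tilde v)=\tilde a(\tilde u,\tilde v)$. The scaled averaging map $I_\Gamma\tilde D:\tilde W\to\hat W$ is $$I_\Gamma\tilde D\,\tilde w=\sum_{r=1}^{N_d}\sum_{X=F,E}\sum_{k\in\mathcal M_X^{(r)}}T_rD_{X_k}^{(r)}w_{X_k,\Delta}^{(r)}+w_\Pi.$$ The preconditioner is $M_{BDDC}^{-1}=(I_\Gamma\tilde D)\tilde S^{-1}(I_\Gamma\tilde D)^H$, and $\hat G=M_{BDDC}^{-1}\hat S$. (The operator $\hat G$ does not depend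 on the choice of inner products and is self-adjoint with respect to $a(\cdot,\cdot)$; $\lambda_{\min},\lambda_{\max}$ are its extreme eigenvalues.) *)

(* Defs.v *)
From HB Require Import structures.
From mathcomp Require Import all_boot all_order all_algebra.
From mathcomp Require Import sesquilinear spectral.
From mathcomp Require Import complex.
From mathcomp Require Import all_classical all_reals all_analysis.

Set Implicit Arguments.
Unset Strict Implicit.
Unset Printing Implicit Defensive.

Import Order.TTheory GRing.Theory Num.Theory.
Import numFieldNormedType.Exports.

Local Open Scope classical_set_scope.
Local Open Scope ring_scope.
Local Open Scope complex_scope.
Local Open Scope sesquilinear_scope.

Section Geometry.
Variable R : realType.
Implicit Types (A B : set 'rV[R]_3) (x y n : 'rV[R]_3).

Definition dot x y : R := \sum_i x 0 i * y 0 i.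
Definition enorm x : R := Num.sqrt (dot x x).

Definition boundary A : set 'rV[R]_3 := closure A `\` A°.

(* Euclidean diameter; the point 0 in the range makes the diameter of the
   empty set 0 instead of -oo. *)
Definition ediam A : \bar R :=
  ereal_sup [set d | d = 0%E \/ exists x y, [/\ A x, A y & d = (enorm (x - y))%:E]].

Local Open Scope ereal_scope.

(* The two-dimensional Hausdorff measure on R^3, normalised by pi/4 so that it
   is the usual surface area on planar pieces. *)
Definition hausdorff2_pre (delta : R) A : \bar R :=
  ereal_inf [set \sum_(0 <= i <oo) ((pi / 4)%:E * (ediam (U i) * ediam (U i)))
    | U in [set U : nat -> set 'rV[R]_3 |
        A `<=` \bigcup_i U i /\ forall i, ediam (U i) <= delta%:E]].

Definition hausdorff2 A : \bar R :=
  ereal_sup [set hausdorff2_pre delta A | delta in [set delta : R | (0 < delta)%R]].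

Local Close Scope ereal_scope.

Definition R3 := g_sigma_algebraType (@open 'rV[R]_3).

Definition surface_int A (f : 'rV[R]_3 -> R) : R :=
  fine (integral (T := R3) hausdorff2 A (fun x => (f x)%:E)).

Definition csurface_int A (f : 'rV[R]_3 -> R[i]) : R[i] :=
  surface_int A (fun x => complex.Re (f x)) +i*
  surface_int A (fun x => complex.Im (f x)).

(* Derivative in direction n, one-sided from -n.  With n the outward normal of
   an element this only uses the values inside that element. *)
Definition nderiv n (f : 'rV[R]_3 -> R[i]) x : R[i] :=
  lim ((fun t : R => (complex.Re (f x) - complex.Re (f (x - t *: n))) / t) @ 0^'+) +i*
  lim ((fun t : R => (complex.Im (f x) - complex.Im (f (x - t *: n))) / t) @ 0^'+).

(* Bounded, connected, open, and locally the strict hypograph of a Lipschitz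
   function in some orthonormal coordinate system. *)
Definition lipschitz_domain A : Prop :=
  [/\ open A, A !=set0, bounded_set A, connected A &
   forall x, boundary A x ->
     exists (Q : 'M[R]_3) (g : 'rV[R]_2 -> R) (L : R),
       [/\ Q *m Q^T = 1%:M,
           forall s t, `|g s - g t| <= L * `|s - t| &
           \forall y \near x,
             A y <-> (y *m Q) 0 ord_max < g (\row_(j < 2) (y *m Q) 0 (inord j))]].

(* A (convex) polyhedron with exactly six facets, given by its outward unit
   normals: each of the six inequalities is irredundant. *)
Record hexahedron := Hexahedron {
  hx_n : 'I_6 -> 'rV[R]_3;
  hx_c : 'I_6 -> R;
  hx_set := [set x | forall i, dot (hx_n i) x < hx_c i];
  hx_unit : forall i, enorm (hx_n i) = 1;
  hx_bounded : bounded_set hx_set;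
  hx_facet : forall i, exists2 x, dot (hx_n i) x = hx_c i &
               forall j, j != i -> dot (hx_n j) x < hx_c j }.

Definition hx_normal (K : hexahedron) x : 'rV[R]_3 :=
  if [pick i | dot (hx_n K i) x == hx_c K i] is Some i then hx_n K i else 0.

Definition expi (t : R) : R[i] := cos t +i* sin t.

End Geometry.

(* Hermitian positive (semi)definite forms on a subspace S, linear in the first
   argument. *)
Section Forms.
Variables (R : realType) (U : lmodType R[i]).
Implicit Types (S : set U) (b : U -> U -> R[i]).

Definition hermitian_on S b : Prop :=
  (forall c u v w, S u -> S v -> S w -> b (c *: u + v) w = c * b u w + b v w) /\
  (forall u v, S u -> S v -> b v u = Num.conj (b u v)).

Definition hpsd_on S b : Prop :=
  hermitian_on S b /\ (forall u, S u -> 0 <= b u u).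

Definition hpd_on S b : Prop :=
  hermitian_on S b /\ (forall u, S u -> u != 0 -> 0 < b u u).

Definition span_of (I : finType) (P : pred I) (f : I -> U) : set U :=
  [set u | exists c : I -> R[i], u = \sum_(i | P i) c i *: f i].

End Forms.

Section Matrices.
Variables (R : realType) (n : nat).
Implicit Types A B X : 'M[R[i]]_n.

Definition penrose A X : Prop :=
  [/\ A *m X *m A = A, X *m A *m X = X,
      (A *m X)^t* = A *m X & (X *m A)^t* = X *m A].

Definition pinv A : 'M[R[i]]_n := xget 0 [set X | penrose A X].

Definition parallel_sum A B : 'M[R[i]]_n := A *m pinv (A + B) *m B.

Definition parallel_sums (s : seq 'M[R[i]]_n) : 'M[R[i]]_n :=
  if s is A :: s' then foldl parallel_sum A s' else 0.

End Matrices.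

Section Setting.
Variable R : realType.

(* The domain with its boundary parts, the hexahedral mesh, the plane wave
   directions and the subdomain partition. *)
Record discretization := Discretization {
  Omega : set 'rV[R]_3;
  Gamma_d : set 'rV[R]_3;
  Gamma_n : set 'rV[R]_3;
  Gamma_r : set 'rV[R]_3;
  Nh : nat;
  elem : 'I_Nh -> hexahedron R;
  kap : 'I_Nh -> R;
  p : nat;
  alpha : 'I_p -> 'rV[R]_3;
  Nd : nat;
  subdom : 'I_Nd -> set 'rV[R]_3;
  Omega_lip : lipschitz_domain Omega;
  Gamma_cover : boundary Omega = closure (Gamma_d `|` Gamma_n `|` Gamma_r);
  Gamma_disj : [/\ Gamma_d `&` Gamma_n = set0, Gamma_d `&` Gamma_r = set0 &
                   Gamma_n `&` Gamma_r = set0];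
  elem_sub : forall k, hx_set (elem k) `<=` Omega;
  elem_disj : forall k j, k != j -> hx_set (elem k) `&` hx_set (elem j) = set0;
  elem_cover : closure Omega = \bigcup_k closure (hx_set (elem k));
  kap_gt0 : forall k, 0 < kap k;
  p_gt0 : (0 < p)%N;
  alpha_unit : forall l, enorm (alpha l) = 1;
  alpha_inj : injective alpha;
  subdom_open : forall r, open (subdom r);
  subdom_sub : forall r, subdom r `<=` Omega;
  subdom_disj : forall r s, r != s -> subdom r `&` subdom s = set0;
  subdom_cover : closure Omega = \bigcup_r closure (subdom r);
  subdom_elem : forall r, exists k, hx_set (elem k) `<=` subdom r }.

Variable P : discretization.

Local Notation C := R[i].
Local Notation Om k := (hx_set (elem k)).

Definition dof : finType := ('I_(Nh P) * 'I_(p P))%type.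

(* A piecewise function: its k-th component carries the values on the closed
   element k, so that the two traces on an interface are kept apart. *)
Definition pwfun : lmodType C := 'I_(Nh P) -> 'rV[R]_3 -> C^o.

Definition planewave (s : dof) : 'rV[R]_3 -> C := fun x =>
  if `[< closure (Om s.1) x >] then expi (kap s.1 * dot x (alpha s.2)) else 0.

Definition phi (s : dof) : pwfun := fun k x => if k == s.1 then planewave s x else 0.

Definition Vp : set pwfun := span_of predT phi.

(* Truncation to the closed subdomain.  The component living on element k is
   the trace from that element of a function supported in the subdomain, hence
   the closure of the intersection. *)
Definition trunc (r : 'I_(Nd P)) (u : pwfun) : pwfun := fun k x =>
  if `[< closure (Om k `&` subdom r) x >] then u k x else 0.

Definition hsize : R := \big[Num.max/0]_(k < Nh P) fine (ediam (Om k)).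

Definition gamma2 (k j : 'I_(Nh P)) := boundary (Om k) `&` boundary (Om j).
Definition gamma1 (k : 'I_(Nh P)) := boundary (Om k) `&` boundary (Omega P).

Definition kap2 (k j : 'I_(Nh P)) : R := (kap k + kap j) / 2.
Definition alpha_c k j : R := hsize^-1 + `|kap2 k j|.
Definition beta_c k j : R := hsize^-1 * `|kap2 k j| ^- 2 + `|kap2 k j|^-1.
Definition theta1 (k : 'I_(Nh P)) : R := hsize^-1 + `|kap k|.
Definition theta2 (k : 'I_(Nh P)) : R :=
  hsize^-1 * `|kap k| ^- 2 + `|kap k|^-1.
Definition theta3 := theta2.

Definition dn (u : pwfun) (k : 'I_(Nh P)) (x : 'rV[R]_3) : C :=
  nderiv (hx_normal (elem k) x) (u k) x.

Definition robin (u : pwfun) (k : 'I_(Nh P)) (x : 'rV[R]_3) : C :=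
  dn u k x + 'i * (kap k)%:C * u k x.

(* The sesquilinear form with all surface integrals restricted to S. *)
Definition form_on (S : set 'rV[R]_3) (u v : pwfun) : C :=
  \sum_k
    ((theta1 k)%:C * csurface_int (gamma1 k `&` Gamma_d P `&` S)
       (fun x => u k x * Num.conj (v k x))
   + (theta2 k)%:C * csurface_int (gamma1 k `&` Gamma_n P `&` S)
       (fun x => dn u k x * Num.conj (dn v k x))
   + (theta3 k)%:C * csurface_int (gamma1 k `&` Gamma_r P `&` S)
       (fun x => robin u k x * Num.conj (robin v k x)))
 + \sum_k \sum_(j | j != k)
    ((alpha_c k j)%:C * csurface_int (gamma2 k j `&` S)
       (fun x => (u k x - u j x) * Num.conj (v k x - v j x))
   + (beta_c k j)%:C * csurface_int (gamma2 k j `&` S)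
       (fun x => (dn u k x + dn u j x) * Num.conj (dn v k x + dn v j x))).

Definition a_form : pwfun -> pwfun -> C := form_on setT.
Definition a_loc (r : 'I_(Nd P)) : pwfun -> pwfun -> C :=
  form_on (closure (subdom r)).

Definition nbr (s : dof) : {set 'I_(Nd P)} :=
  [set r | `[< closure [set x | planewave s x != 0]%classic `&` subdom r !=set0 >]]%SET.

(* A glob is represented by its common index set g = N_G. *)
Definition label : finType := {set 'I_(Nd P)}.
Definition glob (g : label) : {set dof} := [set s | nbr s == g]%SET.
Definition nglob (g : label) : nat := #|glob g|.
Definition gdof (g : label) (l : 'I_(nglob g)) : dof := enum_val l.

Definition isF (g : label) : bool := #|g| == 2%N.
Definition isE (g : label) : bool := #|g| == 4%N.
Definition isV (g : label) : bool := (4 < #|g|)%N.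
Definition isFE (g : label) : bool := isF g || isE g.
Definition isFEV (g : label) : bool := isFE g || isV g.

Definition glob_kinds : Prop :=
  forall s : dof, (#|nbr s| == 1%N) || isFEV (nbr s).

Definition faces_per_subdomain : nat :=
  \max_(r < Nd P) #|[set g : label | [&& isF g, nglob g != 0%N & r \in g]]%SET|.
Definition edges_per_subdomain : nat :=
  \max_(r < Nd P) #|[set g : label | [&& isE g, nglob g != 0%N & r \in g]]%SET|.
Definition subdomains_per_edge : nat :=
  \max_(g : label | isE g && (nglob g != 0%N)) #|g|.

Definition V_I (r : 'I_(Nd P)) : set pwfun :=
  span_of [pred s | nbr s == [set r]%SET] phi.

Definition V_loc (r : 'I_(Nd P)) : set pwfun :=
  [set u | exists v w, [/\ V_I r v,
     span_of [pred s | isFEV (nbr s) && (r \in nbr s)] (fun s => trunc r (phi s)) w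
     & u = v + w]].

Section Harmonic.
(* phic s nu is the interior correction of the interface dof s in D_nu. *)
Variable phic : dof -> 'I_(Nd P) -> pwfun.

Definition is_phic : Prop :=
  forall (s : dof) nu, isFEV (nbr s) -> nu \in nbr s ->
    V_I nu (phic s nu) /\
    forall v, V_I nu v -> a_loc nu (phic s nu) v = - a_loc nu (trunc nu (phi s)) v.

Definition hphi_loc (nu : 'I_(Nd P)) (s : dof) : pwfun := trunc nu (phi s) + phic s nu.

Definition hphi (s : dof) : pwfun := phi s + \sum_(nu in nbr s) phic s nu.

(* W^(nu) without the summand of the glob g. *)
Definition W_without (nu : 'I_(Nd P)) (g : label) : set pwfun :=
  span_of [pred s | [&& isFEV (nbr s), nu \in nbr s & nbr s != g]] (hphi_loc nu).

Variable phibc : dof -> 'I_(Nd P) -> pwfun.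

Definition hphibar (nu : 'I_(Nd P)) (s : dof) : pwfun := hphi_loc nu s + phibc s nu.

Definition is_phibc : Prop :=
  forall (s : dof) nu, isFE (nbr s) -> nu \in nbr s ->
    W_without nu (nbr s) (phibc s nu) /\
    forall v, W_without nu (nbr s) v -> a_loc nu (hphibar nu s) v = 0.

Definition Smat (g : label) (nu : 'I_(Nd P)) : 'M[C]_(nglob g) :=
  \matrix_(l, m) a_loc nu (hphi_loc nu (gdof m)) (hphi_loc nu (gdof l)).

Definition Sbar (g : label) (nu : 'I_(Nd P)) : 'M[C]_(nglob g) :=
  \matrix_(l, m) a_loc nu (hphibar nu (gdof m)) (hphibar nu (gdof l)).

Definition Bmat (g : label) : 'M[C]_(nglob g) :=
  parallel_sums [seq Sbar g nu | nu <- enum g].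

Section Splitting.
Variable D : forall g : label, 'I_(Nd P) -> 'M[C]_(nglob g).

Definition scaling_ok : Prop := forall g, isFE g ->
  (forall nu, nu \in g -> D g nu \in unitmx) /\
  \sum_(nu in g) D g nu = 1%:M.

Definition AD (g : label) : 'M[C]_(nglob g) :=
  \sum_(nu in g) \sum_(mu in g | mu != nu) (D g mu)^t* *m Smat g nu *m D g mu.

(* The columns of T g are the eigenvectors v_1, v_2, and so on; the first
   nDelta g of them are dual, the others primal. *)
Variables (T : forall g : label, 'M[C]_(nglob g))
  (lam : forall g : label, 'I_(nglob g) -> C) (nDelta : label -> nat).

Definition splitting_ok (ThetaF ThetaE : R) : Prop := forall g, isFE g ->
  let Theta := if isF g then ThetaF else ThetaE in
  [/\ T g \in unitmx,
      forall l, AD g *m col l (T g) = lam l *: (Bmat g *m col l (T g)) &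
      forall l m, l != m ->
        (col l (T g))^t* *m AD g *m col m (T g) = 0 /\
        (col l (T g))^t* *m Bmat g *m col m (T g) = 0] /\
  [/\ (nDelta g <= nglob g)%N,
      forall l m : 'I_(nglob g), (l <= m)%N -> `|lam l| <= `|lam m|,
      forall l : 'I_(nglob g), (l < nDelta g)%N -> `|lam l| <= Theta%:C &
      forall l : 'I_(nglob g), (nDelta g <= l)%N -> Theta%:C <= `|lam l|].

(* Pairs (g, l): the l-th basis function of the glob g. *)
Definition gidx : finType := {g : label & 'I_(nglob g)}.

Definition dual_idx (x : gidx) : bool :=
  isFE (tag x) && (tagged x < nDelta (tag x))%N.
Definition prim_idx (x : gidx) : bool :=
  isV (tag x) || (isFE (tag x) && (nDelta (tag x) <= tagged x)%N).

Definition hat_idx : finType := {x : gidx | isFEV (tag x)}.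
Definition Delta_idx : finType :=
  {y : 'I_(Nd P) * gidx | (y.1 \in tag y.2) && dual_idx y.2}.
Definition Pi_idx : finType := {x : gidx | prim_idx x}.

(* \hat W, in coordinates with respect to the basis of all the phi_l^{X_k};
   \tilde W, in coordinates with respect to the bases Phi_Delta^{X_k,r} (one copy
   for each r) and Phi_Pi^{X_k}, Phi_{V_k}. *)
Definition What : vectType C := {ffun hat_idx -> C^o}.
Definition Wtil : vectType C :=
  ({ffun Delta_idx -> C^o} * {ffun Pi_idx -> C^o})%type.

(* Coefficient vectors of a glob component, with respect to Phi_{X_k} for
   elements of \hat W, and with respect to (Phi_Delta, Phi_Pi) padded by zeros for
   elements of \tilde W. *)
Definition hat_coef (w : What) (g : label) : 'cV[C]_(nglob g) :=
  \col_l (if insub (Tagged (fun g => 'I_(nglob g)) l) is Some x then w x else 0).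
Definition Delta_coef (w : Wtil) (r : 'I_(Nd P)) (g : label) : 'cV[C]_(nglob g) :=
  \col_l (if insub (r, Tagged (fun g => 'I_(nglob g)) l) is Some x then w.1 x else 0).
Definition Pi_coef (w : Wtil) (g : label) : 'cV[C]_(nglob g) :=
  \col_l (if insub (Tagged (fun g => 'I_(nglob g)) l) is Some x then w.2 x else 0).

(* The same components with respect to Phi_{X_k}^{(r)} and Phi_{X_k}. *)
Definition wDelta (w : Wtil) (r : 'I_(Nd P)) (g : label) : 'cV[C]_(nglob g) :=
  T g *m Delta_coef w r g.
Definition wPi (w : Wtil) (g : label) : 'cV[C]_(nglob g) :=
  if isFE g then T g *m Pi_coef w g else Pi_coef w g.

Definition hat_inj (g : label) (c : 'cV[C]_(nglob g)) : What :=
  [ffun x => untag 0 (fun l : 'I_(nglob g) => c l 0) (val x)].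

Definition Pi_part (w : Wtil) : What := \sum_(g : label | isFEV g) hat_inj (wPi w g).

Definition hat_fun (w : What) : pwfun :=
  \sum_(g : label | isFEV g) \sum_(l < nglob g) hat_coef w g l 0 *: hphi (gdof l).

Definition loc_fun (r : 'I_(Nd P)) (g : label) (c : 'cV[C]_(nglob g)) : pwfun :=
  \sum_(l < nglob g) c l 0 *: hphi_loc r (gdof l).

(* T^r : \hat W -> W^(r). *)
Definition restr (r : 'I_(Nd P)) (w : What) : pwfun :=
  \sum_(g : label | isFEV g && (r \in g)) loc_fun r (hat_coef w g).

Definition til_loc (r : 'I_(Nd P)) (w : Wtil) : pwfun :=
  \sum_(g : label | isFE g && (r \in g)) loc_fun r (wDelta w r g)
  + restr r (Pi_part w).

Definition a_hat (u v : What) : C := a_form (hat_fun u) (hat_fun v).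
Definition a_til (u v : Wtil) : C := \sum_r a_loc r (til_loc r u) (til_loc r v).

(* The averaging map I_Gamma \tilde D; T_r acts as the identity on coefficients. *)
Definition averaging (w : Wtil) : What :=
  \sum_r \sum_(g : label | isFE g && (r \in g)) hat_inj (D g r *m wDelta w r g)
  + Pi_part w.

End Splitting.
End Harmonic.
End Setting.

Section Spectrum.
Variables (R : realType) (V : vectType R[i]).

Definition lambda_max (G : 'End(V)) : R := sup [set x : R | passmx.leigenvalue G x%:C].
Definition lambda_min (G : 'End(V)) : R := inf [set x : R | passmx.leigenvalue G x%:C].
Definition cond_number (G : 'End(V)) : R := lambda_max G / lambda_min G.

End Spectrum.

(* Main.v *)
(* The operator \hat G is analysed through the map [ext] from \hat W to \tilde W
   that copies the dual coefficients of a function to every subdomain.  It preserves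
   the energy and is a right inverse of the averaging map, so every eigenvalue is at
   least 1, and every eigenvalue is at most the constant K in
   a(avg w, avg w) <= K \tilde a(w, w).
   On the subdomain r, avg w differs from w, on each face or edge g, by
   sum_{nu != r} D_nu (d_nu - d_r), where d_nu is the dual part on nu.  Summing the
   energies of these jumps over the subdomains of g produces the form A^D at the
   vectors d_nu.  Since each d_nu is spanned by eigenvectors with |lambda| <= Theta,
   A^D is bounded on it by Theta times the parallel sum B, even after adding the
   B-orthogonal primal part; and B <= \bar S^(nu), the minimal energy of an extension
   of the glob coefficients, is at most the local energy of w. *)

Require Import Defs.
From HB Require Import structures.
From mathcomp Require Import all_boot all_order all_algebra.
From mathcomp Require Import sesquilinear spectral.
From mathcomp Require Import complex.
From mathcomp Require Import all_classical all_reals all_analysis.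
From mathcomp Require Import lra.

Set Implicit Arguments.
Unset Strict Implicit.
Unset Printing Implicit Defensive.

Import Order.TTheory GRing.Theory Num.Theory.
Import numFieldNormedType.Exports.

Local Open Scope classical_set_scope.
Local Open Scope ring_scope.
Local Open Scope complex_scope.
Local Open Scope sesquilinear_scope.

(** * Hermitian forms on subspaces *)

Section HermitianForms.
Variables (R : realType) (U : lmodType R[i]).
Implicit Types (S : set U) (b : U -> U -> R[i]).

Definition subspace S : Prop :=
  S 0 /\ forall c u v, S u -> S v -> S (c *: u + v).

Lemma subspaceT : subspace [set: U]. Proof. by []. Qed.

Lemma subspace_span (I : finType) (P : pred I) (f : I -> U) :
  subspace (span_of P f).
Proof.
split; first by exists (fun=> 0); rewrite big1 // => i _; rewrite scale0r.
move=> c _ _ [x ->] [y ->]; exists (fun i => c * x i + y i).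
rewrite scaler_sumr -big_split; apply: eq_bigr => i _.
by rewrite scalerDl scalerA.
Qed.

Lemma mem_span (I : finType) (P : pred I) (f : I -> U) i : P i -> span_of P f (f i).
Proof.
move=> Pi; exists (fun j => (j == i)%:R).
rewrite (bigD1 i) //= eqxx scale1r big1 ?addr0 // => j /andP[_ /negPf ->].
by rewrite scale0r.
Qed.

Section Closure.
Variable S : set U.
Hypothesis sS : subspace S.

Lemma subspaceD u v : S u -> S v -> S (u + v).
Proof. by move=> Su Sv; rewrite -[u]scale1r; apply sS.2. Qed.

Lemma subspaceZ c u : S u -> S (c *: u).
Proof. by move=> Su; rewrite -[_ *: _]addr0; apply sS.2 => //; exact: sS.1. Qed.

Lemma subspaceB u v : S u -> S v -> S (u - v).
Proof. by move=> Su Sv; rewrite -scaleN1r; apply/subspaceD/subspaceZ. Qed.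

Lemma subspace_sum (I : Type) (r : seq I) (P : pred I) (u : I -> U) :
  (forall i, P i -> S (u i)) -> S (\sum_(i <- r | P i) u i).
Proof. by move=> Su; elim/big_ind: _ => //; [exact: sS.1|exact: subspaceD]. Qed.

Section Expansion.
Variable b : U -> U -> R[i].
Hypothesis hb : hermitian_on S b.

Lemma herm_addl u v w : S u -> S v -> S w -> b (u + v) w = b u w + b v w.
Proof. by move=> Su Sv Sw; have := hb.1 1 u v w; rewrite scale1r mul1r; apply. Qed.

Lemma herm_0l w : S w -> b 0 w = 0.
Proof.
move=> Sw; have := herm_addl sS.1 sS.1 Sw; rewrite addr0 => /eqP.
by rewrite -subr_eq subrr => /eqP.
Qed.

Lemma herm_scalel c u w : S u -> S w -> b (c *: u) w = c * b u w.
Proof.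
by move=> Su Sw; have := hb.1 c _ _ _ Su sS.1 Sw; rewrite addr0 herm_0l ?addr0.
Qed.

Lemma herm_addr u v w : S u -> S v -> S w -> b w (u + v) = b w u + b w v.
Proof.
move=> Su Sv Sw; rewrite (hb.2 (u + v)) ?(hb.2 u w) ?(hb.2 v w) //.
  by rewrite herm_addl // rmorphD.
exact: subspaceD.
Qed.

Lemma herm_scaler c u w : S u -> S w -> b w (c *: u) = Num.conj c * b w u.
Proof.
move=> Su Sw; rewrite (hb.2 (c *: u)) ?(hb.2 u w) //.
  by rewrite herm_scalel // rmorphM.
exact: subspaceZ.
Qed.

Lemma herm_suml (I : Type) (r : seq I) (P : pred I) (u : I -> U) w :
    (forall i, P i -> S (u i)) -> S w ->
  b (\sum_(i <- r | P i) u i) w = \sum_(i <- r | P i) b (u i) w.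
Proof.
move=> Su Sw; elim: r => [|i r IH]; first by rewrite !big_nil herm_0l.
rewrite !big_cons; case: ifP => // Pi; rewrite herm_addl ?IH //; first exact: Su.
exact: subspace_sum.
Qed.

Lemma herm_sumr (I : Type) (r : seq I) (P : pred I) (u : I -> U) w :
    (forall i, P i -> S (u i)) -> S w ->
  b w (\sum_(i <- r | P i) u i) = \sum_(i <- r | P i) b w (u i).
Proof.
move=> Su Sw; rewrite (hb.2 (\sum_(i <- r | P i) u i)) ?herm_suml ?rmorph_sum //;
  last exact: subspace_sum.
by apply: eq_bigr => i Pi; rewrite (hb.2 _ w) //; apply: Su.
Qed.

Lemma herm_subl u v w : S u -> S v -> S w -> b (u - v) w = b u w - b v w.
Proof.
move=> Su Sv Sw; rewrite -scaleN1r herm_addl ?herm_scalel ?mulN1r //.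
exact: subspaceZ.
Qed.

Lemma herm_subr u v w : S u -> S v -> S w -> b w (u - v) = b w u - b w v.
Proof.
move=> Su Sv Sw; rewrite -scaleN1r herm_addr ?herm_scaler ?rmorphN ?rmorph1 ?mulN1r //.
exact: subspaceZ.
Qed.

Lemma herm_sqB u v : S u -> S v ->
  b (u - v) (u - v) = b u u - b u v - b v u + b v v.
Proof.
move=> Su Sv; have Suv := subspaceB Su Sv.
by rewrite herm_subl // !herm_subr // opprB addrA addrAC.
Qed.

End Expansion.

(** This is positivity at [u - v]. It bounds the sum of both cross terms, which is real even where
    each of them is not. *)
Lemma hpsd_cross_le b u v : hpsd_on S b -> S u -> S v ->
  b u v + b v u <= b u u + b v v.
Proof.
move=> [hb b0] Su Sv; have := b0 _ (subspaceB Su Sv).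
by rewrite (herm_sqB hb) // addrAC subr_ge0 addrAC lerBrDr [b v u + _]addrC.
Qed.

Lemma hpsd_sum_le b (I : finType) (P : pred I) (u : I -> U) :
    hpsd_on S b -> (forall i, P i -> S (u i)) ->
  b (\sum_(i | P i) u i) (\sum_(i | P i) u i)
    <= #|P|%:R * \sum_(i | P i) b (u i) (u i).
Proof.
move=> hb Su; have Ssum := subspace_sum (index_enum I) Su.
have -> : b (\sum_(i | P i) u i) (\sum_(i | P i) u i)
    = \sum_(i | P i) \sum_(j | P j) b (u i) (u j).
  rewrite (herm_suml hb.1) //; apply: eq_bigr => i Pi.
  by rewrite (herm_sumr hb.1) //; apply: Su.
set q := \sum_(i | P i) \sum_(j | P j) b (u i) (u j).
have n_sum : \sum_(i | P i) \sum_(j | P j) b (u j) (u j)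
    = #|P|%:R * \sum_(i | P i) b (u i) (u i).
  by rewrite sumr_const mulr_natl.
(* Doubling both sides and exchanging one copy pairs the term [(i, j)] with [(j, i)], so that
   [hpsd_cross_le] applies to each pair. *)
rewrite -(@ler_pM2l _ 2) // !mulr2n !mulrDl !mul1r -{1}n_sum -{1}n_sum.
rewrite [X in _ <= X + _]exchange_big /= {2}/q exchange_big /= /q.
rewrite -!big_split /=; apply: ler_sum => i Pi; rewrite -!big_split /=.
by apply: ler_sum => j Pj; apply: hpsd_cross_le => //; apply: Su.
Qed.

Lemma hpsd_add_le b u v : hpsd_on S b -> S u -> S v ->
  b (u + v) (u + v) <= 2 * (b u u + b v v).
Proof.
move=> hb Su Sv; pose f (i : bool) := if i then u else v.
have := @hpsd_sum_le b bool predT f hb; rewrite !big_bool /= card_bool.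
by apply; case.
Qed.

Lemma hpsd_sub_le b u v : hpsd_on S b -> S u -> S v ->
  b (u - v) (u - v) <= 2 * (b u u + b v v).
Proof.
move=> hb Su Sv; apply: le_trans (hpsd_add_le hb Su _) _; rewrite -scaleN1r.
  exact: subspaceZ.
rewrite (herm_scalel hb.1) ?(herm_scaler hb.1) //; last exact: subspaceZ.
by rewrite rmorphN rmorph1 !mulN1r opprK.
Qed.

(* Otherwise [b (u - c *: v) (u - c *: v)] would be negative for a large real [c]. *)
Lemma hpsd_isotropic b u v : hpsd_on S b -> S u -> S v ->
  b v v = 0 -> 0 <= b v u -> b v u = 0.
Proof.
move=> hb Su Sv vv0 vu_ge0; apply/eqP/negPn/negP => vu_neq0.
have vu_gt0 : 0 < b v u by rewrite lt_def vu_neq0.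
have uv : b u v = b v u by rewrite (hb.1.2 v u) // conj_Creal // ger0_real.
(* With this [c] the form at [u - c *: v] equals [- (b u u + 2)], which is negative. *)
pose c := (b u u + 1) / b v u.
have uu_ge0 := hb.2 _ Su.
have cr : Num.conj c = c.
  by rewrite conj_Creal // ger0_real // divr_ge0 // addr_ge0.
have Scv := subspaceZ c Sv.
have := hb.2 _ (subspaceB Su Scv).
rewrite (herm_sqB hb.1) // !(herm_scaler hb.1) // !(herm_scalel hb.1) // cr uv vv0.
have q_sub : b u u - (b u u + 1) = - 1 by rewrite opprD addrA subrr add0r.
rewrite !mulr0 addr0 divfK // q_sub -opprD oppr_ge0.
by move=> /(lt_le_trans _)-/(_ 0); rewrite ltxx ltr_wpDr ?addr_ge0 // => /(_ isT).
Qed.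

End Closure.
End HermitianForms.

(** * Positive semidefinite matrices and parallel sums *)

Section AdjointMatrix.
Variable C : numClosedFieldType.

Lemma adjmx_mul m n k (A : 'M[C]_(m, n)) (B : 'M[C]_(n, k)) :
  (A *m B)^t* = B^t* *m A^t*.
Proof. by rewrite trmx_mul map_mxM. Qed.

Lemma adjmx_add m n (A B : 'M[C]_(m, n)) : (A + B)^t* = A^t* + B^t*.
Proof. by rewrite linearD map_mxD. Qed.

Lemma adjmx_sub m n (A B : 'M[C]_(m, n)) : (A - B)^t* = A^t* - B^t*.
Proof. by rewrite linearB map_mxB. Qed.

Lemma adjmx_sqr_ge0 n (y : 'cV[C]_n) : 0 <= (y^t* *m y) 0 0.
Proof.
by rewrite mxE sumr_ge0 // => i _; rewrite !mxE mulrC -normCK exprn_ge0.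
Qed.

Lemma adjmx_sqr_eq0 n (y : 'cV[C]_n) : (y^t* *m y) 0 0 = 0 -> y = 0.
Proof.
rewrite mxE => /eqP; rewrite psumr_eq0 => [/allP y0|i _]; last first.
  by rewrite !mxE mulrC -normCK exprn_ge0.
apply/matrixP => i j; rewrite ord1 mxE; have := y0 i (mem_index_enum i).
by rewrite !mxE mulrC -normCK expf_eq0 /= normr_eq0 => /eqP.
Qed.

Lemma mulmx_sum_col m n (T : 'M[C]_(m, n)) (x : 'cV[C]_n) :
  T *m x = \sum_l x l 0 *: col l T.
Proof.
apply/matrixP => i j; rewrite ord1 mxE summxE.
by apply: eq_bigr => l _; rewrite !mxE mulrC.
Qed.

End AdjointMatrix.

Section PsdMatrices.
Variables (R : realType) (n : nat).
Implicit Types (A B M X : 'M[R[i]]_n) (x y : 'cV[R[i]]_n).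

Definition mxform A x y : R[i] := (y^t* *m A *m x) 0 0.

Definition psdmx A : Prop := A^t* = A /\ forall x, 0 <= mxform A x x.

Lemma mxform_adj A x y : Num.conj (mxform A x y) = mxform (A^t*) y x.
Proof.
rewrite /mxform -[Num.conj _](_ : ((y^t* *m A *m x)^t*) 0 0 = _); last by rewrite !mxE.
by rewrite !adjmx_mul trmxCK mulmxA.
Qed.

Lemma psdmx_hpsd A : psdmx A -> hpsd_on [set: 'cV[R[i]]_n] (mxform A).
Proof.
move=> [Ah A0]; split; last by move=> u _; apply: A0.
split=> [c u v w _ _ _|u v _ _]; last by rewrite mxform_adj Ah.
by rewrite /mxform mulmxDr -scalemxAr !mxE.
Qed.

Lemma mxform_add A B x y : mxform (A + B) x y = mxform A x y + mxform B x y.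
Proof. by rewrite /mxform mulmxDr mulmxDl mxE. Qed.

Lemma mxform_sub A B x y : mxform (A - B) x y = mxform A x y - mxform B x y.
Proof. by rewrite /mxform mulmxBr mulmxBl !mxE. Qed.

Lemma mxform_sum (I : Type) (r : seq I) (P : pred I) (A : I -> 'M[R[i]]_n) x y :
  mxform (\sum_(i <- r | P i) A i) x y = \sum_(i <- r | P i) mxform (A i) x y.
Proof. by rewrite /mxform mulmx_sumr mulmx_suml summxE. Qed.

Lemma mxform_congr A M x y : mxform (M^t* *m A *m M) x y = mxform A (M *m x) (M *m y).
Proof. by rewrite /mxform adjmx_mul !mulmxA. Qed.

Lemma psdmx0 : psdmx (0 : 'M[R[i]]_n).
Proof.
split=> [|x]; last by rewrite /mxform mulmx0 mul0mx mxE.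
by apply/matrixP => i j; rewrite !mxE rmorph0.
Qed.

Lemma psdmx_add A B : psdmx A -> psdmx B -> psdmx (A + B).
Proof.
move=> [Ah A0] [Bh B0]; split=> [|x]; first by rewrite adjmx_add Ah Bh.
by rewrite mxform_add addr_ge0.
Qed.

Lemma psdmx_congr A M : psdmx A -> psdmx (M^t* *m A *m M).
Proof.
move=> [Ah A0]; split=> [|x]; last by rewrite mxform_congr A0.
by rewrite !adjmx_mul trmxCK Ah mulmxA.
Qed.

Lemma psdmx_sum (I : Type) (r : seq I) (P : pred I) (A : I -> 'M[R[i]]_n) :
  (forall i, P i -> psdmx (A i)) -> psdmx (\sum_(i <- r | P i) A i).
Proof. by move=> A0; elim/big_ind: _ => //; [exact: psdmx0|exact: psdmx_add]. Qed.

(** For a column x of [N], the two nonnegative forms of [A] and [B] at x add up to 0, so x is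
    isotropic for [A]; testing against [A *m x] then gives [A *m x = 0]. *)
Lemma psdmx_add_ker A B (N : 'M[R[i]]_n) :
  psdmx A -> psdmx B -> (A + B) *m N = 0 -> A *m N = 0.
Proof.
move=> pA pB ABN; apply/matrixP => i j; rewrite [RHS]mxE.
pose x := col j N.
have ABx : (A + B) *m x = 0 by rewrite /x !colE mulmxA ABN mul0mx.
have Axx : mxform A x x = 0.
  have : mxform A x x + mxform B x x = 0.
    by rewrite -mxform_add /mxform -mulmxA ABx mulmx0 mxE.
  by move/eqP; rewrite paddr_eq0 ?pA.2 ?pB.2 // => /andP[/eqP].
have AxE : mxform A x (A *m x) = ((A *m x)^t* *m (A *m x)) 0 0 by rewrite /mxform mulmxA.
have : A *m x = 0.
  apply: adjmx_sqr_eq0; rewrite -AxE.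
  apply: (hpsd_isotropic (subspaceT _) (psdmx_hpsd pA)) => //.
  by rewrite AxE adjmx_sqr_ge0.
by rewrite /x colE mulmxA -colE => /matrixP/(_ i 0); rewrite !mxE.
Qed.

(** The adjoint of [X] solves the Penrose equations of the Hermitian [M] as well. The proof replays
    their uniqueness: [M *m X = M *m X^t*], hence [M] and [X] commute, and both solutions agree. *)
Lemma penrose_adj M X : M^t* = M -> penrose M X -> X^t* = X.
Proof.
move=> Mh [MXM XMX MXh XMh].
have MXE : M *m X^t* = X *m M by rewrite -[RHS]XMh adjmx_mul Mh.
have XME : X^t* *m M = M *m X by rewrite -[RHS]MXh adjmx_mul Mh.
have MYM : M *m X^t* *m M = M by rewrite -[RHS]Mh -[in RHS]MXM !adjmx_mul Mh mulmxA.
have YMY : X^t* *m M *m X^t* = X^t* by rewrite -[in RHS]XMX !adjmx_mul Mh mulmxA.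
have MX_MY : M *m X = M *m X^t*.
  rewrite -MXh -[in LHS]MYM -mulmxA adjmx_mul MXh MXE XMh -MXE.
  by rewrite mulmxA MXM.
have comm : M *m X = X *m M by rewrite MX_MY.
by rewrite -YMY XME comm -mulmxA MXE -comm mulmxA XMX.
Qed.

(** The second alternative is the default value of [xget]; it turns the parallel sum into 0, which
    satisfies the same bounds. *)
Lemma pinv_penrose A : penrose A (Defs.pinv A) \/ Defs.pinv A = 0.
Proof. by rewrite /Defs.pinv; case: xgetP => [X _ pX|_]; [left|right]. Qed.

(** With M = A + B and X its pseudoinverse, P = A X B equals both A - A X A and B - B X B, and the
    subtracted matrices are congruences of M; this gives the two bounds. Positivity comes from
    writing P as a sum of a congruence of A and one of B. *)
Lemma parallel_sum_psd A B : psdmx A -> psdmx B ->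
  [/\ psdmx (parallel_sum A B),
      forall x, mxform (parallel_sum A B) x x <= mxform A x x &
      forall x, mxform (parallel_sum A B) x x <= mxform B x x].
Proof.
move=> pA pB; rewrite /parallel_sum.
have [pX|->] := pinv_penrose (A + B); last first.
  rewrite mulmx0 mul0mx; split=> [|x|x]; first exact: psdmx0.
    by rewrite {1}/mxform mulmx0 mul0mx mxE pA.2.
  by rewrite {1}/mxform mulmx0 mul0mx mxE pB.2.
have pM := psdmx_add pA pB; move: pX; set X := Defs.pinv _; set M := A + B => pX.
have Xh := penrose_adj pM.1 pX; have [MXM _ _ _] := pX.
(* [M] annihilates [1 - X *m M], hence so does [A] by [psdmx_add_ker]. *)
have AXM : A *m X *m M = A.
  apply/eqP; rewrite -subr_eq0 -{2}[A]mulmx1 -mulmxA -mulmxBr; apply/eqP.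
  by apply: (psdmx_add_ker pA pB); rewrite mulmxBr mulmx1 mulmxA MXM subrr.
have BXM : B *m X *m M = B.
  apply/eqP; rewrite -subr_eq0 -{2}[B]mulmx1 -mulmxA -mulmxBr; apply/eqP.
  by apply: (psdmx_add_ker pB pA); rewrite addrC mulmxBr mulmx1 mulmxA MXM subrr.
have MXA : M *m X *m A = A.
  by rewrite -[RHS]pA.1 -[in RHS]AXM !adjmx_mul pA.1 pM.1 Xh mulmxA.
have MXB : M *m X *m B = B.
  by rewrite -[RHS]pB.1 -[in RHS]BXM !adjmx_mul pB.1 pM.1 Xh mulmxA.
pose P := A *m X *m B.
have PA : P = A - (X *m A)^t* *m M *m (X *m A).
  rewrite adjmx_mul pA.1 Xh AXM mulmxA; apply/eqP.
  by rewrite eq_sym subr_eq addrC -mulmxDr AXM.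
have PB : P = B - (X *m B)^t* *m M *m (X *m B).
  rewrite adjmx_mul pB.1 Xh BXM mulmxA; apply/eqP.
  by rewrite eq_sym subr_eq -!mulmxDl MXB.
have pXAM := psdmx_congr (X *m A) pM; have pXBM := psdmx_congr (X *m B) pM.
have Ph : P^t* = P by rewrite {1}PA adjmx_sub pA.1 pXAM.1 -PA.
have PE : P = (X *m B)^t* *m A *m (X *m B) + (X *m A)^t* *m B *m (X *m A).
  rewrite !adjmx_mul pA.1 pB.1 Xh.
  have BXA : B *m X *m A = P by rewrite -Ph /P !adjmx_mul pA.1 pB.1 Xh mulmxA.
  rewrite BXA -/P -!mulmxDr [B + A]addrC -/M mulmxA /P.
  by rewrite -!mulmxA (mulmxA B) BXM.
split=> [|x|x].
- by rewrite -/P PE; apply: psdmx_add; exact: psdmx_congr.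
- by rewrite -/P PA mxform_sub gerBl pXAM.2.
- by rewrite -/P PB mxform_sub gerBl pXBM.2.
Qed.

Lemma foldl_parallel_sum_psd A (s : seq 'M[R[i]]_n) :
    psdmx A -> (forall B, B \in s -> psdmx B) ->
  psdmx (foldl (@parallel_sum R n) A s) /\
  forall B, B \in A :: s -> forall x,
    mxform (foldl (@parallel_sum R n) A s) x x <= mxform B x x.
Proof.
elim: s A => [|B s IH] A pA ps /=.
  by split=> // B; rewrite inE => /eqP ->.
have [pP PA PB] := parallel_sum_psd pA (ps B (mem_head _ _)).
have [|pF leF] := IH _ pP.
  by move=> D Ds; apply: ps; rewrite inE Ds orbT.
split=> // D; rewrite !inE => /or3P[/eqP ->|/eqP ->|Ds] x.
- by apply: le_trans (PA x); apply: leF; exact: mem_head.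
- by apply: le_trans (PB x); apply: leF; exact: mem_head.
- by apply: leF; rewrite inE Ds orbT.
Qed.

Lemma parallel_sums_psd (s : seq 'M[R[i]]_n) :
    (forall B, B \in s -> psdmx B) ->
  psdmx (parallel_sums s) /\
  forall B, B \in s -> forall x, mxform (parallel_sums s) x x <= mxform B x x.
Proof.
case: s => [_|A s ps]; first by split=> //; exact: psdmx0.
by apply: foldl_parallel_sum_psd => [|B Bs]; apply: ps; rewrite inE ?eqxx ?Bs ?orbT.
Qed.

End PsdMatrices.

(** * Forms at vectors spanned by dual eigenvectors *)

Section DualEnergy.
Variables (R : realType) (n : nat).
Implicit Types (A B T : 'M[R[i]]_n) (x y : 'cV[R[i]]_n).

Lemma mxform_scale A c e x y :
  mxform A (c *: x) (e *: y) = c * Num.conj e * mxform A x y.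
Proof.
rewrite /mxform (_ : (e *: y)^t* = Num.conj e *: y^t*); last first.
  by apply/matrixP => i j; rewrite !mxE rmorphM.
by rewrite -!scalemxAl -scalemxAr scalerA mxE [_ * c]mulrC. Qed.

Lemma mxform_orthogonal A T x : psdmx A ->
    (forall l m, l != m -> mxform A (col m T) (col l T) = 0) ->
  mxform A (T *m x) (T *m x)
    = \sum_l `|x l 0| ^+ 2 * mxform A (col l T) (col l T).
Proof.
move=> /psdmx_hpsd[hA _] orth; rewrite mulmx_sum_col.
rewrite (herm_suml (subspaceT _) hA) //; apply: eq_bigr => l _.
rewrite (herm_sumr (subspaceT _) hA) // (bigD1 l) //= mxform_scale -normCK big1.
  by rewrite addr0.
by move=> m ml; rewrite mxform_scale orth ?mulr0.
Qed.

(* A dual vector [T *m x] may be completed by any primal part: the form of [B]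
   only grows because the eigenvectors are [B]-orthogonal. *)
Lemma dual_energy_le A B T (lam : 'I_n -> R[i]) (k : nat) (theta : R[i]) x y :
    psdmx A -> psdmx B -> 0 <= theta ->
    (forall l, A *m col l T = lam l *: (B *m col l T)) ->
    (forall l m, l != m -> mxform A (col m T) (col l T) = 0) ->
    (forall l m, l != m -> mxform B (col m T) (col l T) = 0) ->
    (forall l : 'I_n, (l < k)%N -> `|lam l| <= theta) ->
    (forall l : 'I_n, (k <= l)%N -> x l 0 = 0) ->
    (forall l : 'I_n, (l < k)%N -> y l 0 = x l 0) ->
  mxform A (T *m x) (T *m x) <= theta * mxform B (T *m y) (T *m y).
Proof.
move=> pA pB theta0 eig oA oB lam_le x0 yx.
rewrite !mxform_orthogonal // mulr_sumr; apply: ler_sum => l _.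
have Bl := pB.2 (col l T).
(* At a primal index the left term is 0 and the right one is nonnegative. *)
have [kl|lk] := leqP k l.
  by rewrite x0 // normr0 expr0n mul0r !mulr_ge0 ?exprn_ge0.
rewrite yx // mulrCA ler_wpM2l ?exprn_ge0 //.
(* The eigenvalue may be complex a priori; the value of [A] at the eigenvector is nonnegative, so it
   equals its modulus, which is the modulus of the eigenvalue times the value of [B]. *)
rewrite -[leLHS]ger0_norm ?pA.2 // {1}/mxform -mulmxA eig -scalemxAr mxE mulmxA.
by rewrite normrM -/(mxform B _ _) (ger0_norm Bl) ler_wpM2r ?lam_le.
Qed.

End DualEnergy.

(** * Jumps produced by the scaled average *)

Section AveragingJump.
Variables (R : realType) (n : nat) (I : finType) (g : {set I}).
Variables (S D : I -> 'M[R[i]]_n) (d : I -> 'cV[R[i]]_n).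
Hypotheses (psdS : forall r, r \in g -> psdmx (S r)).
Hypothesis sumD : \sum_(nu in g) D nu = 1%:M.

Lemma averaging_jump r : r \in g ->
  \sum_(nu in g) D nu *m d nu - d r
    = \sum_(nu | (nu \in g) && (nu != r)) (D nu *m d nu - D nu *m d r).
Proof.
move=> gr; rewrite -{1}[d r]mul1mx -sumD mulmx_suml -sumrB (bigD1 r) //=.
by rewrite subrr add0r.
Qed.

(** On r the jump has at most [#|g|] terms D_nu (d_nu - d_r), which gives the factor [#|g|];
    splitting each difference gives the factor 2. The form of the double sum regroups into the
    values [F r nu m] with nu different from r. *)
Lemma averaging_jump_le :
  \sum_(r in g) mxform (S r) (\sum_(nu in g) D nu *m d nu - d r)
                             (\sum_(nu in g) D nu *m d nu - d r)
  <= #|g|%:R * 2 * \sum_(m in g)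
       mxform (\sum_(nu in g) \sum_(mu in g | mu != nu) (D mu)^t* *m S nu *m D mu)
              (d m) (d m).
Proof.
pose F r nu m := mxform (S r) (D nu *m d m) (D nu *m d m).
have F_ge0 r nu m : r \in g -> 0 <= F r nu m by case/psdS => _; apply.
have -> : \sum_(m in g) mxform (\sum_(nu in g) \sum_(mu in g | mu != nu)
      (D mu)^t* *m S nu *m D mu) (d m) (d m)
    = \sum_(r in g) \sum_(nu in g | nu != r) \sum_(m in g) F r nu m.
  transitivity (\sum_(m in g) \sum_(r in g) \sum_(nu in g | nu != r) F r nu m).
    apply: eq_bigr => m _; rewrite mxform_sum; apply: eq_bigr => r _.
    by rewrite mxform_sum; apply: eq_bigr => nu _; rewrite mxform_congr.
  by rewrite exchange_big; apply: eq_bigr => r _; rewrite exchange_big.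
rewrite mulr_sumr; apply: ler_sum => r gr; have hS := psdmx_hpsd (psdS gr).
rewrite averaging_jump //; apply: le_trans (hpsd_sum_le (subspaceT _) hS _) _ => //.
rewrite -mulrA; apply: ler_pM => //.
- by apply: sumr_ge0 => nu _; case: hS => _; apply.
- rewrite ler_nat; apply/subset_leq_card/fintype.subsetP => nu.
  by rewrite unfold_in => /andP[].
rewrite mulr_sumr; apply: ler_sum => nu /andP[gnu nur].
apply: le_trans (hpsd_sub_le (subspaceT _) hS _ _) _ => //.
(* As nu differs from r, the two required values are distinct terms of a nonnegative sum over m. *)
rewrite ler_pM2l // (bigD1 nu) //= (bigD1 r) /=; last by rewrite gr eq_sym.
rewrite addrA lerDl sumr_ge0 // => m _; exact: F_ge0.
Qed.

End AveragingJump.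

(** * Gram matrices of sesquilinear forms *)

Section GramMatrix.
Variables (R : realType) (U : lmodType R[i]) (S : set U) (b : U -> U -> R[i]).
Variables (n : nat) (f : 'I_n -> U).
Hypotheses (sS : subspace S) (Sf : forall l, S (f l)).

Let comb (x : 'cV[R[i]]_n) : U := \sum_l x l 0 *: f l.

Lemma gram_comb_mem x : S (comb x).
Proof. by apply: subspace_sum => // l _; apply: subspaceZ. Qed.

(** The transposed indexing [b (f m) (f l)] fits a form linear in its first argument, since [mxform]
    conjugates [y]. *)
Lemma mxform_gram x y : hermitian_on S b ->
  mxform (\matrix_(l, m) b (f m) (f l)) x y = b (comb x) (comb y).
Proof.
move=> hb; rewrite /mxform -mulmxA mxE (herm_sumr sS hb); last first.
- exact: gram_comb_mem.
- by move=> l _; apply: subspaceZ.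
apply: eq_bigr => l _; rewrite (herm_scaler sS hb) //; last exact: gram_comb_mem.
rewrite !mxE; congr (_ * _); rewrite (herm_suml sS hb) //; last first.
  by move=> m _; apply: subspaceZ.
by apply: eq_bigr => m _; rewrite (herm_scalel sS hb) // mxE mulrC.
Qed.

Lemma gram_psd : hpsd_on S b -> psdmx (\matrix_(l, m) b (f m) (f l)).
Proof.
move=> [hb b0]; split=> [|x]; last by rewrite mxform_gram // b0 //; exact: gram_comb_mem.
by apply/matrixP => l m; rewrite !mxE -hb.2.
Qed.

End GramMatrix.

(** * Truncation to subdomains *)

Section Geometry.
Variable R : realType.

Lemma expi_neq0 (t : R) : expi t != 0.
Proof.
apply/eqP => -[c0 s0]; have := cos2Dsin2 t.
by rewrite c0 s0 expr0n addr0 => /eqP; rewrite eq_sym oner_eq0.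
Qed.

Lemma dot_continuous (n : 'rV[R]_3) : continuous (dot n).
Proof.
apply: (continuous_big (@add_continuous R)) => i _ x.
apply: (@continuous_comp _ _ _ (fun y : 'rV[R]_3 => y 0 i) ( *%R (n 0 i))).
  exact: coord_continuous.
exact: mulrl_continuous.
Qed.

Lemma hx_set_open (K : hexahedron R) : open (hx_set K).
Proof.
rewrite openE => x Kx; rewrite /interior /=.
apply: (@filter_forall _ _ (fun i y => dot (hx_n K i) y < hx_c K i) (nbhs x) _) => i.
have Kxi : nbhs (dot (hx_n K i) x) [set t | t < hx_c K i].
  by apply: open_nbhs_nbhs; split; [exact: open_lt|exact: Kx].
exact: (dot_continuous Kxi).
Qed.

End Geometry.

Section Truncation.
Variables (R : realType) (P : discretization R).
Local Notation Om k := (hx_set (elem k)).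
Implicit Types (s : dof P) (r : 'I_(Nd P)) (u v : pwfun P).

Lemma planewave_neq0 s x : closure (Om s.1) x -> planewave s x != 0.
Proof. by move=> sx; rewrite /planewave asboolT // expi_neq0. Qed.

Lemma notin_nbr s r : r \notin nbr s -> Om s.1 `&` subdom r = set0.
Proof.
rewrite inE => /asboolPn rs; rewrite -subset0 => x [sx rx]; apply: rs.
exists x; split=> //; apply: subset_closure => /=; apply: planewave_neq0.
exact: subset_closure.
Qed.

(** The closed subdomains cover the element. A point of the open element in the closure of some D_r'
    has points of D_r' nearby inside the element, so r' belongs to [nbr s], which leaves only r.
    Truncation to D_r therefore loses nothing of an interior basis function. *)
Lemma elem_closure_subdom s r : nbr s = [set r]%SET ->
  closure (Om s.1) `<=` closure (Om s.1 `&` subdom r).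
Proof.
move=> sr y sy; apply: closed_closure; apply: closureS sy => x sx.
have [r' _ r'x] : (\bigcup_r' closure (subdom (d := P) r')) x.
  by rewrite -subdom_cover; apply: subset_closure; exact: elem_sub sx.
have [r'r|r'r] := eqVneq r' r.
  rewrite {}r'r in r'x; move=> B Bx.
  have := r'x _ (filterI Bx (open_nbhs_nbhs (conj (@hx_set_open R (elem s.1)) sx))).
  by move=> [z [rz [Bz sz]]]; exists z.
have [z [r'z sz]] := r'x _ (open_nbhs_nbhs (conj (@hx_set_open R (elem s.1)) sx)).
have : r' \notin nbr s by rewrite sr inE.
by move=> /notin_nbr/seteqP[/(_ z (conj sz r'z))].
Qed.

Lemma trunc_linear r c u v : trunc r (c *: u + v) = c *: trunc r u + trunc r v.
Proof.
apply/funext => k; apply/funext => x; rewrite /trunc !fctE /=.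
by case: ifP => // _; rewrite scaler0 addr0.
Qed.

Lemma trunc0 r : trunc r 0 = 0 :> pwfun P.
Proof. by apply/funext => k; apply/funext => x; rewrite /trunc; case: ifP. Qed.

Lemma truncD r u v : trunc r (u + v) = trunc r u + trunc r v.
Proof. by rewrite -[u in LHS]scale1r trunc_linear scale1r. Qed.

Lemma truncZ r c u : trunc r (c *: u) = c *: trunc r u.
Proof. by rewrite -[c *: u]addr0 trunc_linear trunc0 addr0. Qed.

Lemma trunc_sum r (I : Type) (l : seq I) (Q : pred I) (u : I -> pwfun P) :
  trunc r (\sum_(i <- l | Q i) u i) = \sum_(i <- l | Q i) trunc r (u i).
Proof. exact: (big_morph _ (truncD r) (trunc0 r)). Qed.

Lemma trunc_phi_out s r : r \notin nbr s -> trunc r (phi s) = 0.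
Proof.
move=> /notin_nbr sr; apply/funext => k; apply/funext => x; rewrite /trunc /phi.
case: (eqVneq k s.1) => [->|_]; last by case: ifP.
by rewrite sr closure0 asboolF.
Qed.

Lemma trunc_phi_in s r : nbr s = [set r]%SET -> trunc r (phi s) = phi s.
Proof.
move=> sr; apply/funext => k; apply/funext => x; rewrite /trunc /phi.
case: (eqVneq k s.1) => [->|_]; last by case: ifP.
case: asboolP => // nx; rewrite /planewave asboolF // => sx.
exact/nx/elem_closure_subdom.
Qed.

Lemma trunc_V_I r nu u : V_I nu u -> trunc r u = if r == nu then u else 0.
Proof.
move=> [c ->]; rewrite trunc_sum; case: eqVneq => [->|rnu].
  by apply: eq_bigr => s /eqP snu; rewrite truncZ trunc_phi_in.
rewrite big1 // => s /eqP snu.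
by rewrite truncZ trunc_phi_out ?scaler0 // snu inE.
Qed.

Lemma V_I_Vp nu u : V_I nu u -> Vp u.
Proof.
move=> [c ->]; apply: (subspace_sum (subspace_span _ _)) => s _.
by apply: (subspaceZ (subspace_span _ _)); apply: mem_span.
Qed.

Lemma subspace_V_loc r : subspace (V_loc (P := P) r).
Proof.
split=> [|c _ _ [v [w [Vv Vw ->]]] [v' [w' [Vv' Vw' ->]]]].
  by exists 0, 0; split; rewrite ?addr0 //; apply: (subspace_span _ _).1.
exists (c *: v + v'), (c *: w + w'); split; try exact: (subspace_span _ _).2.
by rewrite scalerDr addrACA.
Qed.

Section Harmonic.
Variable phic : dof P -> 'I_(Nd P) -> pwfun P.
Hypothesis phicP : is_phic phic.

(** Each correction lies in the interior space of its own subdomain, so truncation to D_r keeps only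
    the correction indexed by r. *)
Lemma trunc_hphi r s : isFEV (nbr s) ->
  trunc r (hphi phic s) = if r \in nbr s then hphi_loc phic r s else 0.
Proof.
move=> s_fev; rewrite truncD trunc_sum.
have trunc_phic nu : nu \in nbr s -> trunc r (phic s nu) = if r == nu then phic s nu else 0.
  by move=> snu; apply/trunc_V_I; have [] := phicP s_fev snu.
case: ifPn => rs.
  rewrite (bigD1 r) //= trunc_phic // eqxx big1 ?addr0 // => nu /andP[snu nur].
  by rewrite trunc_phic // eq_sym (negPf nur).
rewrite trunc_phi_out // add0r big1 // => nu snu.
by rewrite trunc_phic //; case: eqP snu rs => // -> ->.
Qed.

Lemma hphi_Vp s : isFEV (nbr s) -> Vp (hphi phic s).
Proof.
move=> s_fev; apply: (subspaceD (subspace_span _ _)); first exact: mem_span.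
apply: (subspace_sum (subspace_span _ _)) => nu snu.
by have [/V_I_Vp] := phicP s_fev snu.
Qed.

Lemma hphi_loc_V_loc r s : isFEV (nbr s) -> r \in nbr s ->
  V_loc r (hphi_loc phic r s).
Proof.
move=> s_fev rs; have [Vphic _] := phicP s_fev rs.
exists (phic s r), (trunc r (phi s)); split=> //; last exact: addrC.
exact: (@mem_span _ _ _ [pred s | isFEV (nbr s) && (r \in nbr s)]
  (fun s => trunc r (phi s)) s (introT andP (conj s_fev rs))).
Qed.

Lemma W_without_V_loc r g u : W_without phic r g u -> V_loc r u.
Proof.
move=> [c ->]; apply: (subspace_sum (@subspace_V_loc r)) => s /and3P[s_fev rs _].
by apply: (subspaceZ (@subspace_V_loc r)); apply: hphi_loc_V_loc.
Qed.

End Harmonic.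

End Truncation.

(** * Coefficients and energies of the partially coupled space *)

Section Coefficients.
Variables (R : realType) (P : discretization R).
Variable (phic : dof P -> 'I_(Nd P) -> pwfun P).
Variables (D : forall g : label P, 'I_(Nd P) -> 'M[R[i]]_(nglob g)).
Variables (T : forall g : label P, 'M[R[i]]_(nglob g)).
Variable nDelta : label P -> nat.
Implicit Types (g : label P) (r : 'I_(Nd P)) (u v : What P) (w : Wtil nDelta).

Lemma nbr_gdof g (l : 'I_(nglob g)) : nbr (gdof l) = g.
Proof. by have := enum_valP l; rewrite inE => /eqP. Qed.

Lemma isFE_FEV g : isFE g -> isFEV g.
Proof. by rewrite /isFEV => ->. Qed.

Lemma isFE_notV g : isFE g -> isV g = false.
Proof. by rewrite /isFE /isF /isE /isV => /orP[]/eqP ->. Qed.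

Lemma hat_coefE u g (l : 'I_(nglob g)) (gfev : isFEV g) :
  hat_coef u g l 0 = u (exist _ (Tagged (fun g => 'I_(nglob g)) l) gfev).
Proof. by rewrite mxE insubT. Qed.

Lemma hat_coef_inj u v :
  (forall g, isFEV g -> hat_coef u g = hat_coef v g) -> u = v.
Proof.
move=> uv; apply/ffunP => -[[g l] gfev].
have := congr1 (fun M : 'cV_(nglob g) => M l 0) (uv g gfev).
by rewrite /= !hat_coefE.
Qed.

Lemma hat_coef_linear c u v g :
  hat_coef (c *: u + v) g = c *: hat_coef u g + hat_coef v g.
Proof.
apply/matrixP => l j; rewrite !mxE; case: insubP => [x _ _|_].
  by rewrite !ffunE.
by rewrite mulr0 addr0.
Qed.

Lemma hat_coefD u v g : hat_coef (u + v) g = hat_coef u g + hat_coef v g.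
Proof. by rewrite -[u in LHS]scale1r hat_coef_linear scale1r. Qed.

Lemma hat_coef0 g : hat_coef (0 : What P) g = 0.
Proof. by apply/matrixP => l j; rewrite !mxE; case: insubP => // x; rewrite ffunE. Qed.

Lemma hat_coef_sum (I : Type) (s : seq I) (Q : pred I) (u : I -> What P) g :
  hat_coef (\sum_(i <- s | Q i) u i) g = \sum_(i <- s | Q i) hat_coef (u i) g.
Proof. exact: (big_morph (fun u => hat_coef u g) (fun u v => hat_coefD u v g) (hat_coef0 g)). Qed.

Lemma hat_coef_hat_inj (c : forall g, 'cV[R[i]]_(nglob g)) g g' : isFEV g ->
  hat_coef (hat_inj (c g')) g = if g' == g then c g else 0.
Proof.
move=> gfev; apply/matrixP => l j; rewrite ord1 hat_coefE ffunE /=.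
case: eqVneq => [->|g'g]; last by rewrite untag_dflt ?mxE //= eq_sym.
by rewrite (@untagE _ _ _ 0 g _ (Tagged (fun g => 'I_(nglob g)) l) erefl).
Qed.

Lemma hat_coef_sum_hat_inj (Q : pred (label P)) (c : forall g, 'cV[R[i]]_(nglob g)) g :
    isFEV g ->
  hat_coef (\sum_(g' | Q g') hat_inj (c g')) g = if Q g then c g else 0.
Proof.
move=> gfev; rewrite hat_coef_sum; case: ifPn => Qg.
  rewrite (bigD1 g) //= hat_coef_hat_inj // eqxx big1 ?addr0 // => g' /andP[_ g'g].
  by rewrite hat_coef_hat_inj // (negPf g'g).
rewrite big1 // => g' Qg'; rewrite hat_coef_hat_inj //.
by case: eqP Qg' Qg => // -> ->.
Qed.

(** The coefficients on g of the local part of [w] in D_r, with respect to the local harmonic basis: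
    the dual copy owned by r plus the shared primal part. *)
Definition til_coef w r g : 'cV[R[i]]_(nglob g) :=
  (if isFE g then wDelta T w r g else 0) + wPi T w g.

Lemma hat_coef_Pi_part w g : isFEV g -> hat_coef (Pi_part T w) g = wPi T w g.
Proof. by move=> gfev; rewrite hat_coef_sum_hat_inj // gfev. Qed.

Lemma hat_coef_averaging w g : isFEV g ->
  hat_coef (averaging D T w) g
    = (if isFE g then \sum_(r in g) D g r *m wDelta T w r g else 0) + wPi T w g.
Proof.
move=> gfev; rewrite hat_coefD hat_coef_Pi_part // hat_coef_sum; congr (_ + _).
under eq_bigr => r _.
  rewrite (hat_coef_sum_hat_inj (fun g => isFE g && (r \in g))
    (fun g => D g r *m wDelta T w r g)) //.
  over.
case: ifP => gfe /=; first by rewrite -big_mkcond.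
by rewrite big1.
Qed.

Lemma loc_fun_linear r g c (x y : 'cV[R[i]]_(nglob g)) :
  loc_fun phic r (c *: x + y) = c *: loc_fun phic r x + loc_fun phic r y.
Proof.
rewrite /loc_fun scaler_sumr -big_split; apply: eq_bigr => l _.
by rewrite !mxE scalerDl scalerA.
Qed.

Lemma loc_funD r g (x y : 'cV[R[i]]_(nglob g)) :
  loc_fun phic r (x + y) = loc_fun phic r x + loc_fun phic r y.
Proof. by rewrite -[x in LHS]scale1r loc_fun_linear scale1r. Qed.

Lemma loc_fun0 r g : loc_fun phic r (0 : 'cV[R[i]]_(nglob g)) = 0.
Proof. by rewrite /loc_fun big1 // => l _; rewrite mxE scale0r. Qed.

Lemma restrE r u (c : forall g, 'cV[R[i]]_(nglob g)) :
    (forall g, isFEV g -> r \in g -> hat_coef u g = c g) ->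
  restr phic r u = \sum_(g : label P | isFEV g && (r \in g)) loc_fun phic r (c g).
Proof. by move=> uc; apply: eq_bigr => g /andP[gfev rg]; rewrite uc. Qed.

Lemma til_locE r w : til_loc phic T r w
  = \sum_(g : label P | isFEV g && (r \in g)) loc_fun phic r (til_coef w r g).
Proof.
rewrite /til_loc (restrE (c := wPi T w)) => [|g gfev _]; last exact: hat_coef_Pi_part.
rewrite big_mkcond [in RHS]big_mkcond [X in _ + X]big_mkcond -big_split /=.
apply: eq_bigr => g _; rewrite /til_coef /isFEV.
case: (isFE g) => /=; first by case: (r \in g); rewrite ?loc_funD ?addr0.
by rewrite add0r; case: ifP => // _; rewrite add0r.
Qed.

End Coefficients.

(** * Energy bound for the averaging map *)

Section EnergyBounds.
Variables (R : realType) (P : discretization R).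
Variables (phic phibc : dof P -> 'I_(Nd P) -> pwfun P).
Variables (D : forall g : label P, 'I_(Nd P) -> 'M[R[i]]_(nglob g)).
Variables (T : forall g : label P, 'M[R[i]]_(nglob g)).
Variables (lam : forall g : label P, 'I_(nglob g) -> R[i]).
Variable nDelta : label P -> nat.
Variables ThetaF ThetaE : R.
Hypothesis ThetaF_ge1 : 1 <= ThetaF.
Hypothesis a_loc_psd : forall r : 'I_(Nd P), hpsd_on (V_loc r) (a_loc r).
Hypothesis phicP : is_phic phic.
Hypothesis phibcP : is_phibc phic phibc.
Hypothesis scalingP : scaling_ok D.
Hypothesis splittingP : splitting_ok phic phibc D T lam nDelta ThetaF ThetaE.
Implicit Types (g : label P) (r : 'I_(Nd P)) (u v : What P) (w : Wtil nDelta).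

Local Notation energy r u := (a_loc r u u).
Local Notation til r w := (til_loc phic T r w).
Local Notation Theta := (Num.max ThetaF ThetaE).

Lemma hphi_loc_gdof r g (l : 'I_(nglob g)) : isFEV g -> r \in g ->
  V_loc r (hphi_loc phic r (gdof l)).
Proof. by move=> gfev rg; apply: hphi_loc_V_loc => //; rewrite nbr_gdof. Qed.

Lemma loc_fun_V_loc r g (c : 'cV[R[i]]_(nglob g)) : isFEV g -> r \in g ->
  V_loc r (loc_fun phic r c).
Proof.
move=> gfev rg.
by apply: (gram_comb_mem (@subspace_V_loc _ _ r)) => l; apply: hphi_loc_gdof.
Qed.

Lemma Smat_psd r g : isFEV g -> r \in g -> psdmx (Smat phic g r).
Proof.
move=> gfev rg; apply: (gram_psd (@subspace_V_loc _ _ r) _ (a_loc_psd r)) => l.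
exact: hphi_loc_gdof.
Qed.

Lemma energy_loc_fun r g (c : 'cV[R[i]]_(nglob g)) : isFEV g -> r \in g ->
  energy r (loc_fun phic r c) = mxform (Smat phic g r) c c.
Proof.
move=> gfev rg; rewrite (mxform_gram (@subspace_V_loc _ _ r) _ _ _ (a_loc_psd r).1) //.
by move=> l; apply: hphi_loc_gdof.
Qed.

Lemma til_loc_V_loc r w : V_loc r (til r w).
Proof.
rewrite til_locE; apply: (subspace_sum (@subspace_V_loc _ _ r)) => g /andP[gfev rg].
exact: loc_fun_V_loc.
Qed.

Lemma hphibar_V_loc r g (l : 'I_(nglob g)) : isFE g -> r \in g ->
  V_loc r (hphibar phic phibc r (gdof l)).
Proof.
move=> gfe rg; apply: (subspaceD (@subspace_V_loc _ _ r)).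
  by apply: hphi_loc_gdof => //; apply: isFE_FEV.
apply: (W_without_V_loc phicP (g := g)).
by have [] := phibcP (s := gdof l) (nu := r); rewrite nbr_gdof.
Qed.

Lemma Sbar_psd r g : isFE g -> r \in g -> psdmx (Sbar phic phibc g r).
Proof.
move=> gfe rg; apply: (gram_psd (@subspace_V_loc _ _ r) _ (a_loc_psd r)) => l.
exact: hphibar_V_loc.
Qed.

(* [Sbar] is the Schur complement onto the glob: it gives the least energy among
   all extensions of given glob coefficients. *)
Lemma Sbar_le_energy r g w : isFE g -> r \in g ->
  mxform (Sbar phic phibc g r) (til_coef T w r g) (til_coef T w r g) <= energy r (til r w).
Proof.
move=> gfe rg; have sV := @subspace_V_loc _ _ r; have gfev := isFE_FEV gfe.
have sW := @subspace_span _ _ _ [pred s | [&& isFEV (nbr s), r \in nbr s & nbr s != g]]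
  (hphi_loc phic r).
set c := til_coef T w r g.
(* [h] is the minimal-energy extension of [c]. The remainder [z] has no component on g and is
   orthogonal to [h], so the energy of the local part is that of [h] plus that of [z]. *)
pose h : pwfun P := \sum_(l < nglob g) c l 0 *: hphibar phic phibc r (gdof l).
pose z := til r w - h.
have Wz : W_without phic r g z.
  rewrite /z til_locE (bigD1 g) ?gfev //= addrAC; apply: (subspaceD sW).
    (* On g itself the basis functions cancel and only the corrections [phibc] remain. *)
    rewrite /loc_fun /h -sumrB; apply: (subspace_sum sW) => l _.
    rewrite -scalerBr; apply: (subspaceZ sW).
    rewrite /hphibar opprD addrA subrr add0r -scaleN1r; apply: (subspaceZ sW).
    by have [] := phibcP (s := gdof l) (nu := r); rewrite nbr_gdof.
  apply: (subspace_sum sW) => g' /andP[/andP[g'fev rg'] g'g].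
  apply: (subspace_sum sW) => l _; apply: (subspaceZ sW).
  by apply: mem_span; rewrite /= nbr_gdof g'fev rg'.
have Vz := W_without_V_loc phicP Wz.
have Vb l : V_loc r (hphibar phic phibc r (gdof (g := g) l)) by apply: hphibar_V_loc.
have Vh : V_loc r h by apply: (gram_comb_mem sV).
have hz : a_loc r h z = 0.
  rewrite (herm_suml sV (a_loc_psd r).1) //; last by move=> l _; apply: (subspaceZ sV).
  rewrite big1 // => l _; rewrite (herm_scalel sV (a_loc_psd r).1) //.
  have [] := phibcP (s := gdof l) (nu := r); rewrite ?nbr_gdof // => _ ->; rewrite ?mulr0 //.
have -> : til r w = h + z by rewrite /z addrC subrK.
have Vhz := subspaceD sV Vh Vz.
rewrite (mxform_gram sV Vb _ _ (a_loc_psd r).1) -/h.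
have hb := (a_loc_psd r).1.
rewrite (herm_addl hb Vh Vz Vhz) (herm_addr sV hb Vh Vz Vh) (herm_addr sV hb Vh Vz Vz).
rewrite (hb.2 h z Vh Vz) hz rmorph0 add0r addr0 lerDl.
exact: (a_loc_psd r).2.
Qed.

Lemma Bmat_psd g : isFE g -> psdmx (Bmat phic phibc g).
Proof.
move=> gfe; apply: (parallel_sums_psd _).1 => B /mapP[r].
by rewrite mem_enum => rg ->; apply: Sbar_psd.
Qed.

Lemma Bmat_le_Sbar r g x : isFE g -> r \in g ->
  mxform (Bmat phic phibc g) x x <= mxform (Sbar phic phibc g r) x x.
Proof.
move=> gfe rg; apply: (parallel_sums_psd _).2.
  by move=> B /mapP[r']; rewrite mem_enum => rg' ->; apply: Sbar_psd.
by apply: map_f; rewrite mem_enum.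
Qed.

Lemma AD_psd g : isFE g -> psdmx (AD phic D g).
Proof.
move=> gfe; apply: psdmx_sum => nu nug; apply: psdmx_sum => mu _.
by apply: psdmx_congr; apply: Smat_psd => //; apply: isFE_FEV.
Qed.

(** This chains [dual_energy_le], which passes from A^D at the dual part to B at all coefficients on
    g, with the comparison of B with [Sbar] and the minimality of [Sbar]. *)
Lemma dual_coef_le r g w : isFE g -> r \in g ->
  mxform (AD phic D g) (wDelta T w r g) (wDelta T w r g)
    <= Theta%:C * energy r (til r w).
Proof.
move=> gfe rg; have [[_ eig orth] [_ _ lam_le _]] := splittingP gfe.
have Theta0 : 0 <= Theta by rewrite le_max (le_trans ler01).
apply: (@le_trans _ _ (Theta%:C *
  mxform (Bmat phic phibc g) (til_coef T w r g) (til_coef T w r g))); last first.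
  rewrite ler_wpM2l ?ler0c //; apply: le_trans (Bmat_le_Sbar _ gfe rg) _.
  exact: Sbar_le_energy.
have -> : til_coef T w r g = T g *m (Delta_coef w r g + Pi_coef w g).
  by rewrite /til_coef /wPi gfe mulmxDr.
rewrite /wDelta; apply: (dual_energy_le (lam := @lam g) (k := nDelta g)) => //.
- exact: AD_psd.
- exact: Bmat_psd.
- by rewrite ler0c.
- by move=> l m lm; have [Aorth _] := orth l m lm; rewrite /mxform Aorth mxE.
- by move=> l m lm; have [_ Borth] := orth l m lm; rewrite /mxform Borth mxE.
- move=> l /lam_le/le_trans; apply; rewrite lecR.
  by rewrite le_max; case: ifP => _; rewrite lexx ?orbT.
(* The padding by zeros: dual coefficients vanish at primal indices and, in the next case, primal
   ones at dual indices. *)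
- move=> l ml; rewrite mxE; case: insubP => // x.
  by rewrite /dual_idx /= ltnNge ml /= !andbF.
- move=> l lm; rewrite mxE [Pi_coef w g l 0]mxE.
  case: insubP => [x|_]; last by rewrite addr0.
  by rewrite /prim_idx /= isFE_notV // leqNgt lm /= andbF.
Qed.

Local Notation interface r g := [&& isFE g, nglob g != 0%N & r \in g].
Local Notation globs_per_subdomain := (faces_per_subdomain P + edges_per_subdomain P)%N.

(** Labels range over all sets of subdomains; [nglob g != 0] keeps those that are globs of the mesh,
    as in the two maxima on the right. *)
Lemma card_interface r :
  (#|[pred g : label P | interface r g]| <= globs_per_subdomain)%N.
Proof.
pose faces := [set g : label P | [&& isF g, nglob g != 0%N & r \in g]]%SET.
pose edges := [set g : label P | [&& isE g, nglob g != 0%N & r \in g]]%SET.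
apply: (@leq_trans #|faces :|: edges|%SET).
  apply/subset_leq_card/fintype.subsetP => g.
  by rewrite !inE /isFE => /and3P[gfe -> ->]; rewrite !andbT.
apply: leq_trans (leq_card_setU _ _) _; apply: leq_add.
  exact: (leq_bigmax (F := fun r =>
    #|[set g : label P | [&& isF g, nglob g != 0%N & r \in g]]%SET|)).
exact: (leq_bigmax (F := fun r =>
  #|[set g : label P | [&& isE g, nglob g != 0%N & r \in g]]%SET|)).
Qed.

Definition jump w r g : 'cV[R[i]]_(nglob g) :=
  \sum_(nu in g) D g nu *m wDelta T w nu g - wDelta T w r g.

Lemma restr_averaging r w :
  restr phic r (averaging D T w)
    = til r w + \sum_(g : label P | interface r g) loc_fun phic r (jump w r g).
Proof.
have coef g : isFEV g -> r \in g -> hat_coef (averaging D T w) g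
    = til_coef T w r g + (if isFE g then jump w r g else 0).
  move=> gfev _; rewrite hat_coef_averaging // /til_coef /jump.
  by case: isFE; rewrite ?addr0 // [RHS]addrC addrA subrK.
rewrite (restrE phic coef) til_locE.
rewrite (eq_bigr (fun g => loc_fun phic r (til_coef T w r g)
  + loc_fun phic r (if isFE g then jump w r g else 0))); last by move=> g _; exact: loc_funD.
rewrite big_split /=; congr (_ + _).
rewrite big_mkcond [RHS]big_mkcond; apply: eq_bigr => g _; rewrite /isFEV.
case: (isFE g) => /=; last by rewrite loc_fun0 if_same.
(* An empty glob contributes an empty sum, so it may be dropped from the count. *)
case: eqVneq => [g0|//]; rewrite /loc_fun big1 ?if_same // => l _.
by have /lt0n_neq0/eqP := leq_ltn_trans (leq0n _) (ltn_ord l).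
Qed.

Lemma jump_energy_le g w : isFE g ->
  \sum_(r in g) energy r (loc_fun phic r (jump w r g))
    <= 8 * Theta%:C * \sum_(r in g) energy r (til r w).
Proof.
move=> gfe; have gfev := isFE_FEV gfe; have [_ sumD] := scalingP gfe.
apply: (@le_trans _ _ (\sum_(r in g) mxform (Smat phic g r) (jump w r g) (jump w r g))).
  by apply: ler_sum => r rg; rewrite energy_loc_fun.
apply: le_trans (averaging_jump_le _ _ sumD) _ => [r rg|]; first exact: Smat_psd.
(* A face has two subdomains and an edge four; 8 is twice the larger number. *)
have card_g : #|g|%:R * 2 <= 8 :> R[i].
  rewrite -natrM ler_nat; move: gfe; rewrite /isFE /isF /isE.
  by case/orP => /eqP ->.
have Asum_ge0 : 0 <= \sum_(r in g) mxform (AD phic D g) (wDelta T w r g) (wDelta T w r g).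
  by apply: sumr_ge0 => r _; apply: (AD_psd gfe).2.
apply: (@le_trans _ _ (8 * \sum_(r in g) mxform (AD phic D g) (wDelta T w r g) (wDelta T w r g))).
  exact: ler_wpM2r.
rewrite -mulrA ler_pM2l // mulr_sumr; apply: ler_sum => r rg.
exact: dual_coef_le.
Qed.

(** The outer 2 separates the local part from the jumps. One factor N comes from summing at most N
    jumps in a subdomain, the other from counting the energy of a subdomain once for each of its
    faces and edges; 8 and Theta come from [jump_energy_le]. *)
Lemma averaging_energy_le w :
  \sum_r energy r (restr phic r (averaging D T w))
    <= (2 * (1 + 8 * globs_per_subdomain%:R ^+ 2) * Theta)%:C
       * \sum_r energy r (til r w).
Proof.
set N := globs_per_subdomain.
have energy_ge0 r (x : pwfun P) : V_loc r x -> 0 <= energy r x by exact: (a_loc_psd r).2.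
have Theta1 : 1 <= Theta by rewrite le_max ThetaF_ge1.
have jump_V_loc r g : interface r g -> V_loc r (loc_fun phic r (jump w r g)).
  by case/and3P=> gfe _ rg; apply: loc_fun_V_loc => //; apply: isFE_FEV.
have til_ge0 r : 0 <= energy r (til r w) by apply/energy_ge0/til_loc_V_loc.
have loc r : energy r (restr phic r (averaging D T w))
    <= 2 * (energy r (til r w) + N%:R * \sum_(g : label P | interface r g)
              energy r (loc_fun phic r (jump w r g))).
  have sV := @subspace_V_loc _ P r; rewrite restr_averaging.
  have Vsum := subspace_sum sV (index_enum _) (jump_V_loc r).
  apply: le_trans (hpsd_add_le sV (a_loc_psd r) (til_loc_V_loc r w) Vsum) _.
  rewrite ler_pM2l // lerD2l.
  apply: le_trans (hpsd_sum_le sV (a_loc_psd r) (jump_V_loc r)) _.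
  apply: ler_wpM2r; last by rewrite ler_nat card_interface.
  by apply: sumr_ge0 => g gi; apply/energy_ge0/jump_V_loc.
apply: le_trans (ler_sum _ (fun r _ => loc r)) _.
rewrite -mulr_sumr big_split /= -mulr_sumr.
set E := \sum_r energy r (til r w).
have jumps : \sum_r \sum_(g : label P | interface r g)
    energy r (loc_fun phic r (jump w r g)) <= 8 * Theta%:C * (N%:R * E).
  (* The jump bound is available only after summing over all subdomains of a glob, so the globs
     become the outer index. *)
  rewrite (exchange_big_dep (fun g => isFE g && (nglob g != 0%N))) /=; last first.
    by move=> r g _ /and3P[-> ->].
  apply: (@le_trans _ _ (\sum_(g : label P | isFE g && (nglob g != 0%N))
      8 * Theta%:C * \sum_(r in g) energy r (til r w))).
    apply: ler_sum => g /andP[gfe g0]; apply: le_trans _ (jump_energy_le w gfe).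
    by rewrite (eq_bigl (fun r => r \in g)) // => r; rewrite gfe g0.
  rewrite -mulr_sumr; apply: ler_wpM2l.
    by rewrite mulr_ge0 // ler0c (le_trans ler01).
  rewrite (exchange_big_dep predT) //= mulr_sumr; apply: ler_sum => r _.
  rewrite sumr_const -[leLHS]mulr_natl ler_wpM2r // ler_nat.
  apply: leq_trans (card_interface r); apply/subset_leq_card/fintype.subsetP => g.
  by rewrite !inE => /andP[/andP[-> ->] ->].
have E_ge0 : 0 <= E by apply: sumr_ge0.
apply: (@le_trans _ _ (2 * (E + N%:R * (8 * Theta%:C * (N%:R * E))))).
  by rewrite ler_pM2l // lerD2l ler_wpM2l.
have -> : 2 * (E + N%:R * (8 * Theta%:C * (N%:R * E)))
    = (2 * (1 + N%:R * (8 * Theta * N%:R)))%:C * E.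
  rewrite !(rmorphM, rmorphD, rmorph1, rmorph_nat) /=.
  by rewrite !mulrA -[X in 2 * (X + _)]mul1r -mulrDl mulrA.
apply: ler_wpM2r => //; rewrite lecR.
(* Theta is at least 1, so the summand 1 is absorbed into 1 times Theta. *)
have : 0 <= N%:R :> R by rewrite ler0n.
move: Theta1; set t := Theta; set m := N%:R => t1 m0.
nra.
Qed.

End EnergyBounds.

(** * Spectrum of the preconditioned operator *)

Section Spectrum.
Variables (R : realType) (V W : vectType R[i]).

Lemma leigenvalueP (G : 'End(V)) (l : R[i]) : passmx.leigenvalue G l ->
  exists2 u, u != 0 & G u = l *: u.
Proof.
rewrite /passmx.leigenvalue /passmx.leigenspace -vpick0 => u0.
set U := lker _ in u0; exists (vpick U) => //.
have := memv_pick U; rewrite memv_ker add_lfunE opp_lfunE scale_lfunE id_lfunE.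
by rewrite subr_eq0 => /eqP.
Qed.

Section FictitiousSpace.
Variables (a ip : V -> V -> R[i]) (bt ipt : W -> W -> R[i]).
Variables (E : 'Hom(W, V)) (ext : V -> W) (K : R).
Variables (Shat : 'End(V)) (Stil : 'End(W)) (EH : 'Hom(V, W)).
Hypotheses (bt_hpd : hpd_on [set: W] bt) (ip_hpd : hpd_on [set: V] ip).
Hypothesis ipt_hpd : hpd_on [set: W] ipt.
Hypothesis ShatE : forall u v, ip (Shat u) v = a u v.
Hypothesis StilE : forall u v, ipt (Stil u) v = bt u v.
Hypothesis EHE : forall u w, ipt (EH u) w = ip u (E w).
Hypothesis extK : forall u, E (ext u) = u.
Hypothesis ext_form : forall u v, a u v = bt (ext u) (ext v).
Hypothesis E_bounded : forall w, a (E w) (E w) <= K%:C * bt w w.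

(** Positive definiteness makes [Stil] injective, and an injective endomorphism in finite dimension
    is invertible. *)
Lemma Stil_inv : cancel (Stil^-1)%VF Stil.
Proof.
apply: lker0_lfunVK; apply/lker0P; apply: raddf_inj => u Su0.
apply/eqP/negPn/negP => u0; have := bt_hpd.2 u I u0.
by rewrite -StilE Su0 (herm_0l (subspaceT _) ipt_hpd.1) // ltxx.
Qed.

(** This is the fictitious space argument. The vector z = S~^-1 E^H S^ u represents the functional
    a(u, E w) for the form [bt]; comparing z with [ext u] bounds l from below, and [E_bounded] at z
    bounds it from above. *)
Lemma leigenvalue_bounds (l : R[i]) :
  passmx.leigenvalue ((E \o Stil^-1 \o EH) \o Shat)%VF l -> 1 <= l <= K%:C.
Proof.
case/leigenvalueP => u u0; rewrite !comp_lfunE /=.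
set z := (Stil^-1)%VF _ => Ez.
have bt_z w : bt z w = a u (E w) by rewrite -StilE Stil_inv EHE ShatE.
have alpha0 : 0 < a u u.
  rewrite ext_form; apply: bt_hpd.2 => //; apply: contra_neq u0 => ext0.
  by rewrite -[u]extK ext0 linear0.
have alphar : Num.conj (a u u) = a u u by rewrite conj_Creal // gtr0_real.
have a_scaler c : a u (c *: u) = Num.conj c * a u u.
  by rewrite -ShatE (herm_scaler (subspaceT _) ip_hpd.1) // ShatE.
have bt_psd : hpsd_on [set: W] bt.
  split=> [|w _]; first exact: bt_hpd.1.
  have [->|w0] := eqVneq w 0; first by rewrite (herm_0l (subspaceT _) bt_hpd.1).
  exact/ltW/bt_hpd.2.
(* This product is the energy of [z - ext u]. *)
have lbar : 0 <= (Num.conj l - 1) * a u u.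
  have := bt_psd.2 (z - ext u) I.
  rewrite (herm_sqB (subspaceT _) bt_hpd.1) // (bt_hpd.1.2 z (ext u)) // !bt_z extK.
  by rewrite Ez a_scaler alphar -ext_form subrK mulrBl mul1r.
have lbar1 : 1 <= Num.conj l by move: lbar; rewrite pmulr_lge0 // subr_ge0.
(* In the order of the complex numbers, being at least 1 includes being real. *)
have lr : Num.conj l = l.
  by rewrite -[RHS]conjCK [RHS]conj_Creal // ger0_real // (le_trans ler01).
rewrite lr in lbar1; rewrite lbar1 /=.
have l0 : 0 < l by apply: lt_le_trans lbar1.
have := E_bounded z; rewrite bt_z Ez.
rewrite -[leLHS]ShatE linearZ (herm_scalel (subspaceT _) ip_hpd.1) // ShatE.
by rewrite !a_scaler lr mulrA [leRHS]mulrA !ler_pM2r.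
Qed.

End FictitiousSpace.

Lemma cond_number_le (G : 'End(V)) (K : R) : 0 <= K ->
  (forall l, passmx.leigenvalue G l -> 1 <= l <= K%:C) -> cond_number G <= K.
Proof.
move=> K0 bounds; rewrite /cond_number /lambda_max /lambda_min.
set X := [set x | _].
have Xb x : X x -> 1 <= x <= K by move/bounds; rewrite -[1]/(1%:C) !lecR.
(* Without real eigenvalues, as on the zero space, the supremum is 0 by convention and so is the
   quotient. *)
have [->|/set0P X0] := eqVneq X set0; first by rewrite sup0 mul0r.
have inf1 : 1 <= inf X by apply: lb_le_inf => // x /Xb/andP[].
have supK : sup X <= K by apply: ge_sup => // x /Xb/andP[].
rewrite ler_pdivrMr ?(lt_le_trans ltr01) //; apply: le_trans supK _.
by rewrite ler_peMr.
Qed.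

End Spectrum.

(** * The energy-preserving right inverse of averaging *)

Section Extension.
Variables (R : realType) (P : discretization R).
Variable (phic : dof P -> 'I_(Nd P) -> pwfun P).
Variables (D : forall g : label P, 'I_(Nd P) -> 'M[R[i]]_(nglob g)).
Variables (T : forall g : label P, 'M[R[i]]_(nglob g)).
Variable nDelta : label P -> nat.
Implicit Types (g : label P) (r : 'I_(Nd P)) (u v : What P) (w : Wtil nDelta).

Lemma Delta_coef_linear r g c w w' :
  Delta_coef (c *: w + w') r g = c *: Delta_coef w r g + Delta_coef w' r g.
Proof.
apply/matrixP => l j; rewrite !mxE; case: insubP => [x _ _|_].
  by rewrite !ffunE.
by rewrite mulr0 addr0.
Qed.

Lemma Pi_coef_linear g c w w' :
  Pi_coef (c *: w + w') g = c *: Pi_coef w g + Pi_coef w' g.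
Proof.
apply/matrixP => l j; rewrite !mxE; case: insubP => [x _ _|_].
  by rewrite !ffunE.
by rewrite mulr0 addr0.
Qed.

Lemma averaging_linear c w w' :
  averaging D T (c *: w + w') = c *: averaging D T w + averaging D T w'.
Proof.
apply: hat_coef_inj => g gfev; rewrite hat_coef_linear !hat_coef_averaging //.
have wDelta_linear r : wDelta T (c *: w + w') r g = c *: wDelta T w r g + wDelta T w' r g.
  by rewrite /wDelta Delta_coef_linear mulmxDr scalemxAr.
have -> : wPi T (c *: w + w') g = c *: wPi T w g + wPi T w' g.
  by rewrite /wPi Pi_coef_linear; case: ifP => // _; rewrite mulmxDr scalemxAr.
rewrite scalerDr addrACA; congr (_ + _); case: ifP => _; last by rewrite scaler0 addr0.
rewrite scaler_sumr -big_split; apply: eq_bigr => r _ /=.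
by rewrite wDelta_linear mulmxDr -scalemxAr.
Qed.

HB.instance Definition _ := GRing.isLinear.Build R[i] (Wtil nDelta) (What P) *:%R
  (@averaging R P D T nDelta) averaging_linear.

(** The inverse of [T] passes to the eigenvector basis on faces and edges; vertex globs keep their
    original basis. *)
Definition split_coef u (x : gidx P) : R[i] :=
  if isFE (tag x) then (invmx (T (tag x)) *m hat_coef u (tag x)) (tagged x) 0
  else hat_coef u (tag x) (tagged x) 0.

Definition ext u : Wtil nDelta :=
  ([ffun y => split_coef u (val y).2], [ffun x => split_coef u (val x)]).

Lemma til_coef_ext r g u : (isFE g -> T g \in unitmx) -> isFEV g -> r \in g ->
  til_coef T (ext u) r g = hat_coef u g.
Proof.
move=> Tunit gfev rg; rewrite /til_coef /wPi /wDelta.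
case: ifPn => [gfe|gfe].
  rewrite -mulmxDr -[RHS]mul1mx -(mulmxV (Tunit gfe)) -mulmxA; congr (_ *m _).
  apply/matrixP => l j; rewrite ord1 mxE [Delta_coef _ _ _ _ _]mxE [Pi_coef _ _ _ _]mxE.
  (* Exactly one of the two padded vectors carries the coefficient at [l]; the other has its default
     0 there. *)
  have [lk|kl] := ltnP l (nDelta g).
    rewrite insubT ?rg /dual_idx /= ?gfe // => p.
    rewrite insubF; last by rewrite /prim_idx /= isFE_notV // leqNgt lk /= andbF.
    by rewrite ffunE /= /split_coef /= gfe addr0.
  rewrite insubF; last by rewrite /dual_idx /= ltnNge kl /= !andbF.
  rewrite insubT /prim_idx /= ?gfe ?kl ?orbT // => p.
  by rewrite ffunE /= /split_coef /= gfe add0r.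
have gv : isV g by move: gfev; rewrite /isFEV (negPf gfe).
rewrite add0r; apply/matrixP => l j; rewrite ord1 mxE.
rewrite insubT /prim_idx /= ?gv // => p.
by rewrite ffunE /= /split_coef /= (negPf gfe).
Qed.

(** All subdomains of a glob hold the same dual part, so the scaling matrices, which sum to the
    identity, reproduce it. *)
Lemma averaging_ext u : (forall g, isFE g -> T g \in unitmx) -> scaling_ok D ->
  averaging D T (ext u) = u.
Proof.
move=> Tunit scalingP; apply: hat_coef_inj => g gfev; rewrite hat_coef_averaging //.
have coef r : r \in g -> til_coef T (ext u) r g = hat_coef u g.
  by move=> rg; apply: til_coef_ext => //; exact: Tunit.
case: ifPn => gfe; last first.
  (* A vertex glob has more than four subdomains; any one of them serves to read off the
     coefficients. *)
  have : (0 < #|g|)%N by move: gfev; rewrite /isFEV (negPf gfe) => /ltnW/ltnW/ltnW/ltnW.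
  by case/card_gt0P => r /coef; rewrite /til_coef (negPf gfe).
have -> : \sum_(r in g) D g r *m wDelta T (ext u) r g
    = \sum_(r in g) D g r *m (hat_coef u g - wPi T (ext u) g).
  by apply: eq_bigr => r /coef <-; rewrite /til_coef gfe addrK.
by rewrite -mulmx_suml (scalingP g gfe).2 mul1mx subrK.
Qed.

Lemma til_loc_ext r u : (forall g, isFE g -> T g \in unitmx) ->
  til_loc phic T r (ext u) = restr phic r u.
Proof.
move=> Tunit; rewrite til_locE; apply: eq_bigr => g /andP[gfev rg].
by rewrite til_coef_ext //; exact: Tunit.
Qed.

Lemma hat_fun_Vp u : is_phic phic -> Vp (hat_fun phic u).
Proof.
move=> phicP; have sV := subspace_span predT (@phi R P).
apply: (subspace_sum sV) => g gfev; apply: (subspace_sum sV) => l _.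
by apply: (subspaceZ sV); apply: hphi_Vp => //; rewrite nbr_gdof.
Qed.

Lemma trunc_hat_fun r u : is_phic phic -> trunc r (hat_fun phic u) = restr phic r u.
Proof.
move=> phicP; rewrite trunc_sum /restr big_mkcond [RHS]big_mkcond /=.
apply: eq_bigr => g _; case: ifP => //= gfev; rewrite trunc_sum.
rewrite (eq_bigr (fun l => hat_coef u g l 0 *:
  (if r \in g then hphi_loc phic r (gdof l) else 0))) => [|l _].
  by case: ifP => // _; rewrite big1 // => l _; rewrite scaler0.
by rewrite truncZ trunc_hphi // nbr_gdof.
Qed.

(** The global form splits over truncations, and truncating a discrete harmonic function gives its
    local restriction. *)
Lemma a_hat_restr u v : is_phic phic ->
    (forall x y : pwfun P, Vp x -> Vp y ->
      a_form x y = \sum_(r < Nd P) a_loc r (trunc r x) (trunc r y)) ->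
  a_hat phic u v = \sum_r a_loc r (restr phic r u) (restr phic r v).
Proof.
move=> phicP a_split; rewrite /a_hat a_split; try exact: hat_fun_Vp.
by apply: eq_bigr => r _; rewrite !trunc_hat_fun.
Qed.

End Extension.

Theorem theorem4p1 (R : realType) :
  exists C : nat -> nat -> nat -> R,
  forall (P : discretization R) (ThetaF ThetaE : R)
    (phic phibc : dof P -> 'I_(Nd P) -> pwfun P)
    (D : forall g : label P, 'I_(Nd P) -> 'M[R[i]]_(nglob g))
    (T : forall g : label P, 'M[R[i]]_(nglob g))
    (lam : forall g : label P, 'I_(nglob g) -> R[i])
    (nDelta : label P -> nat)
    (iph : What P -> What P -> R[i])
    (ipt : Wtil nDelta -> Wtil nDelta -> R[i])
    (Shat : 'End(What P)) (Stil : 'End(Wtil nDelta))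
    (avgH : 'Hom(What P, Wtil nDelta)),
  1 <= ThetaF -> 1 <= ThetaE ->
  glob_kinds P ->
  hpd_on (Vp (P := P)) (a_form (P := P)) ->
  (forall r : 'I_(Nd P), hpsd_on (V_loc r) (a_loc r)) ->
  (forall r : 'I_(Nd P), hpd_on (V_I r) (a_loc r)) ->
  (forall u v : pwfun P, Vp u -> Vp v ->
    a_form u v = \sum_(r < Nd P) a_loc r (trunc r u) (trunc r v)) ->
  is_phic phic ->
  (forall (g : label P) nu, isFE g -> nglob g != 0%N -> nu \in g ->
    hpd_on (W_without phic nu g) (a_loc nu)) ->
  is_phibc phic phibc ->
  scaling_ok D ->
  splitting_ok phic phibc D T lam nDelta ThetaF ThetaE ->
  hpd_on [set: Wtil nDelta] (a_til phic T (nDelta := nDelta)) ->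
  hpd_on [set: What P] iph ->
  hpd_on [set: Wtil nDelta] ipt ->
  (forall u v, iph (Shat u) v = a_hat phic u v) ->
  (forall u v, ipt (Stil u) v = a_til phic T u v) ->
  (forall u w, ipt (avgH u) w = iph u (averaging D T w)) ->
  let M := (linfun (averaging D T (nDelta := nDelta)) \o Stil^-1 \o avgH)%VF in
  let G : 'End(What P) := (M \o Shat)%VF in
  (forall l : R[i], passmx.leigenvalue G l -> 0 < l) /\
  cond_number G <=
    C (faces_per_subdomain P) (edges_per_subdomain P) (subdomains_per_edge P)
    * Num.max ThetaF ThetaE.
Proof.
(* The constant of [averaging_energy_le] with Theta taken out. *)
pose C (f e s : nat) : R := 2 * (1 + 8 * (f + e)%:R ^+ 2).
exists C => P ThetaF ThetaE phic phibc D T lam nDelta iph ipt Shat Stil avgH.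
move=> ThetaF1 _ _ _ a_loc_psd _ a_split phicP _ phibcP scalingP splittingP.
move=> til_hpd iph_hpd ipt_hpd ShatE StilE avgHE M G.
set K := C _ _ _ * _.
have Tunit g : isFE g -> T g \in unitmx by move=> /splittingP[[]].
have avgE w : linfun (averaging D T (nDelta := nDelta)) w = averaging D T w.
  exact: lfunE.
have bounds l : passmx.leigenvalue G l -> 1 <= l <= K%:C.
  apply: (leigenvalue_bounds (ext := ext T nDelta) til_hpd iph_hpd ipt_hpd ShatE StilE).
  - by move=> u w; rewrite avgE; apply: avgHE.
  - by move=> u; rewrite avgE; apply: averaging_ext.
  (* Energy is preserved because the local parts of [ext u] are the restrictions of [u]. *)
  - move=> u v; rewrite (a_hat_restr _ _ phicP a_split) /a_til.
    by apply: eq_bigr => r _; rewrite !til_loc_ext.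
  - move=> w; rewrite avgE (a_hat_restr _ _ phicP a_split).
    exact: (averaging_energy_le ThetaF1 a_loc_psd phicP phibcP scalingP splittingP).
split=> [l /bounds/andP[l1 _]|]; first exact: lt_le_trans l1.
apply: cond_number_le bounds.
by rewrite !mulr_ge0 ?addr_ge0 ?mulr_ge0 ?exprn_ge0 // le_max (le_trans ler01).
Qed.
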